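(* Let $a,b\ge 2$ be integers and let $s\ge1$. The $h^*$-vectors of the matroid basis polytopes $P_{S(a,\ldots,a)}$ (with $s$ entries equal to $a$) and $P_{S(a,b)}$ are unimodal.
   Context: For lattice paths $U,L$ from $(0,0)$ to $(m,r)$ using unit steps $(1,0),(0,1)$ with $L$ never above $U$, the lattice path matroid $M[U,L]$ is the matroid on $\{1,\dots,r+m\}$ whose bases are the index sets of $(0,1)$-steps of lattice paths never above $U$ and never below $L$. The snake $S(a_1,\dots,a_n)$ is the lattice path matroid whose diagram (region between $U$ and $L$), starting from the origin, consists of a horizontal row of $a_1$ unit squares to the right, then a vertical column of $a_2$ unit squares upward, then a horizontal row of $a_3$ squares to the right, and so on, where the last square counted by each $a_i$ coincides with the first square counted by $a_{i+1}$. $P_M=\mathrm{conv}\{\sum_{i\in B}e_i: B\text{ a basis}\}$. For a lattice polytope $P$ of dimension $d$ with Ehrhart polynomial $L_P(t)=\#(tP\cap\mathbb{Z}^n)$, the $h^*$-vector $(h^*_0,\dots,h^*_d)$ is defined by $\sum_{t\ge0}L_P(t)z^t=\frac{\sum_{j=0}^d h^*_j z^j}{(1-z)^{d+1}}$, equivalently $L_P(t)=\sum_{j=0}^d h^*_j\binom{t+d-j}{d}$. A vector $(c_0,\dots,c_d)$ is unimodal if there is $p$ with $c_{i-1}\le c_i$ for $i\le p$ and $c_j\ge c_{j+1}$ for $j\ge p$. *)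

(* Defs.v *)
From HB Require Import structures.
From mathcomp Require Import all_boot all_order all_algebra finmap.
From mathcomp Require Import boolp classical_sets functions cardinality reals.
From mathcomp Require Import zify.

Set Implicit Arguments.
Unset Strict Implicit.
Unset Printing Implicit Defensive.

Import Order.TTheory GRing.Theory Num.Theory.

Local Open Scope classical_set_scope.
Local Open Scope ring_scope.

(* A lattice path starting at the origin is the word of its unit steps:
   [true] is the step (0,1) and [false] is the step (1,0). *)

Definition path_to (m r : nat) (p : seq bool) : bool :=
  (count_mem false p == m) && (count_mem true p == r).

Definition height (p : seq bool) (k : nat) : nat := count_mem true (take k p).

(* After k steps every path is on the antidiagonal x + y = k, so "p is never
   above q" compares the ordinates of the two paths antidiagonal by
   antidiagonal. *)
Definition never_above (n : nat) (p q : seq bool) : bool :=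
  [forall k : 'I_n.+1, (height p k <= height q k)%N].

(* The steps of a path are numbered from 0, so that the ground set
   {1, ..., r + m} is 'I_(r + m). *)
Definition north_steps (n : nat) (p : n.-tuple bool) : {set 'I_n} :=
  [set i | tnth p i].

(* The family of bases of M[U, L], for U and L paths from (0,0) to (m,r). *)
Definition lpm_bases (m r : nat) (U L : seq bool) : {set {set 'I_(r + m)}} :=
  [set north_steps p | p : (r + m).-tuple bool &
     [&& path_to m r p, never_above (r + m) p U & never_above (r + m) L p]].

(* The moves from each square of a snake to the next one: consecutive entries
   of [a] share a square, so an entry k contributes k - 1 moves. The direction
   of the first run is [d]. *)
Fixpoint snake_moves (d : bool) (a : seq nat) : seq bool :=
  if a is k :: a' then nseq k.-1 d ++ snake_moves (~~ d) a' else [::].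

(* U runs along the upper left corners of the squares of the snake, and L
   along their lower right corners; see [snake_diagramP] below. *)
Definition snake_upper (a : seq nat) : seq bool :=
  true :: rcons (snake_moves false a) false.

Definition snake_lower (a : seq nat) : seq bool :=
  false :: rcons (snake_moves false a) true.

Definition snake_width (a : seq nat) : nat := count_mem false (snake_upper a).

Definition snake_height (a : seq nat) : nat := count_mem true (snake_upper a).

Definition snake_bases (a : seq nat) :
    {set {set 'I_(snake_height a + snake_width a)}} :=
  lpm_bases (snake_width a) (snake_height a) (snake_upper a) (snake_lower a).

Definition conv (R : realType) (E : lmodType R) (A : set E) : set E :=
  [set x | exists k (c : 'I_k -> R) (v : 'I_k -> E),
     [/\ forall i, 0 <= c i, \sum_i c i = 1, forall i, A (v i)
       & x = \sum_i c i *: v i]].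

Definition basis_polytope (R : realType) (n : nat) (Bs : {set {set 'I_n}}) :
    set 'rV[R]_n :=
  conv [set v | exists2 B, B \in Bs & v = \sum_(i in B) delta_mx 0 i].
Arguments basis_polytope R {n} Bs.

Definition snake_polytope (R : realType) (a : seq nat) :
    set 'rV[R]_(snake_height a + snake_width a) :=
  basis_polytope R (snake_bases a).
Arguments snake_polytope R a : clear implicits.

Definition affinely_independent (R : realType) (n k : nat)
    (v : 'I_k.+1 -> 'rV[R]_n) : bool :=
  row_free (\matrix_(i < k) (v (lift ord0 i) - v ord0)).

Definition polytope_dim (R : realType) (n : nat) (P : set 'rV[R]_n) : nat :=
  \max_(k < n.+1 | `[< exists v : 'I_k.+1 -> 'rV[R]_n,
      (forall i, P (v i)) /\ affinely_independent v >]) k.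

Definition dilate_lattice_points (R : realType) (n : nat) (P : set 'rV[R]_n)
    (t : nat) : set 'rV[int]_n :=
  [set z | exists2 x, P x & map_mx intr z = t%:R *: x].

(* [fset_set] is meaningful on finite sets only; for basis polytopes, see
   [finite_dilate_lattice_points] below. *)
Definition ehrhart (R : realType) (n : nat) (P : set 'rV[R]_n) (t : nat) : nat :=
  #|` fset_set (dilate_lattice_points P t)|.

(* In the binomial coefficient, the truncated subtraction is exact (j <= d),
   and 'C(t + d - j, d) = 0 for t < j: it is the coefficient of z^t in
   z^j / (1 - z)^(d+1). *)
Definition is_hstar_vector (R : realType) (n : nat) (P : set 'rV[R]_n)
    (h : seq int) : Prop :=
  let d := polytope_dim P in
  size h = d.+1 /\
  forall t : nat,
    (ehrhart P t)%:Z = \sum_(j < d.+1) h`_j * ('C(t + d - j, d))%:Z.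

Definition unimodal (c : seq int) : Prop :=
  exists2 p, (p < size c)%N &
    (forall i, (0 < i <= p)%N -> c`_i.-1 <= c`_i) /\
    (forall j, (p <= j)%N -> (j.+1 < size c)%N -> c`_j.+1 <= c`_j).

Lemma is_hstar_vector_unique (R : realType) (n : nat) (P : set 'rV[R]_n)
    (h h' : seq int) :
  is_hstar_vector P h -> is_hstar_vector P h' -> h = h'.
Proof.
move=> [sh hE] [sh' hE']; apply: (@eq_from_nth _ 0); first by rewrite sh sh'.
move=> i; rewrite sh; move: i; apply: ltn_ind => i IH lti.
have := hE i; rewrite hE' => /esym.
rewrite (bigD1 (Ordinal lti)) //= [RHS](bigD1 (Ordinal lti)) //=.
rewrite addKn binn !mulr1.
set x := bigop _ _ _; set y := bigop _ _ _; suff -> : x = y by move/addIr.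
apply: eq_bigr => j nj; case: (ltngtP j i) => ji.
- by rewrite (IH j) // (ltn_trans ji lti).
- rewrite bin_small ?mulr0 // ltn_subLR; first by rewrite ltn_add2r.
  by rewrite (leq_trans _ (leq_addl _ _)) // -ltnS.
- by case/eqP: nj; apply: val_inj.
Qed.

Lemma basis_polytope_unit_cube (R : realType) (n : nat)
    (Bs : {set {set 'I_n}}) (x : 'rV[R]_n) :
  basis_polytope R Bs x -> forall i, 0 <= x 0 i <= 1.
Proof.
case=> k [c [v [c0 c1 vB ->]]] i.
have v01 j : 0 <= v j 0 i <= 1.
  have [B _ ->] := vB j; rewrite summxE.
  under eq_bigr do rewrite mxE eqxx /=.
  case: (boolP (i \in B)) => iB.
    rewrite (bigD1 i) //= eqxx big1 ?addr0 ?ler01 ?lexx // => l /andP[_ li].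
    by rewrite eq_sym (negbTE li).
  rewrite big1 ?lexx ?ler01 // => l lB.
  by case: eqP => // il; rewrite il lB in iB.
rewrite summxE; apply/andP; split.
  by apply: sumr_ge0 => j _; rewrite mxE mulr_ge0 //; case/andP: (v01 j).
rewrite -c1; apply: ler_sum => j _; rewrite mxE ler_piMr //.
by case/andP: (v01 j).
Qed.

Lemma finite_dilate_lattice_points (R : realType) (n : nat)
    (Bs : {set {set 'I_n}}) (t : nat) :
  finite_set (dilate_lattice_points (basis_polytope R Bs) t).
Proof.
pose f (g : {ffun 'I_n -> 'I_t.+1}) : 'rV[int]_n := \row_i (g i : nat)%:Z.
apply: (@sub_finite_set _ _ (f @` setT)); last exact: finite_image.
move=> z [x /basis_polytope_unit_cube x01 zx].
have z0t i : 0 <= z 0 i <= t%:Z.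
  have := congr1 (fun u : 'rV[R]_n => u 0 i) zx; rewrite !mxE => zi.
  have /andP[x0 x1] := x01 i.
  apply/andP; split; rewrite -(ler_int R) zi ?mulr_ge0 ?ler0n //.
  by rewrite -[leRHS]mulr1 ler_wpM2l ?ler0n.
exists [ffun i => inord (absz (z 0 i))] => //.
apply/rowP => i; rewrite mxE ffunE; have /andP[z0 zt] := z0t i.
by rewrite inordK ?gez0_abs // ltnS -lez_nat gez0_abs.
Qed.

(* The squares of the snake, each given by its lower left corner, as they are
   described run by run: k squares in the direction [d], starting from the
   square (x, y), then the next run from the last of these. *)
Fixpoint snake_squares (d : bool) (x y : nat) (a : seq nat) : seq (nat * nat) :=
  if a is k :: a' then
    [seq (if d then (x, y + i) else (x + i, y))%N | i <- iota 0 k] ++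
    (if d then snake_squares (~~ d) x (y + k.-1) a'
     else snake_squares (~~ d) (x + k.-1) y a')
  else [::].

Lemma height_cons (b : bool) (p : seq bool) (k : nat) :
  height (b :: p) k.+1 = (b + height p k)%N.
Proof. by case: b. Qed.

Lemma height_rcons (b : bool) (p : seq bool) (k : nat) :
  (k <= size p)%N -> height (rcons p b) k = height p k.
Proof. by move=> kp; rewrite /height -cats1 takel_cat. Qed.

Lemma height_nseq_cat (d : bool) (n k : nat) (p : seq bool) :
  height (nseq n d ++ p) k =
  if (k <= n)%N then (d * k)%N else (d * n + height p (k - n))%N.
Proof.
rewrite /height take_cat size_nseq; case: (ltngtP k n) => kn.
- by rewrite take_nseq 1?ltnW // count_nseq; case: d.
- by rewrite count_cat count_nseq; case: d.
- by rewrite kn subnn take0 cats0 count_nseq; case: d.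
Qed.

Lemma snake_squaresP (d : bool) (x y : nat) (a : seq nat) (u v : nat) :
  all (leq 1) a -> a != [::] ->
  ((u, v) \in snake_squares d x y a) =
  [&& (x <= u)%N, (y <= v)%N,
      (u - x + (v - y) <= size (snake_moves d a))%N
    & height (snake_moves d a) (u - x + (v - y)) == (v - y)%N].
Proof.
elim: a d x y => // k a IH d x y /= /andP[k0 a0] _.
set m := snake_moves (~~ d) a.
have -> : ((u, v) \in [seq (if d then (x, y + i) else (x + i, y))%N
                         | i <- iota 0 k] ++
    (if d then snake_squares (~~ d) x (y + k.-1) a
     else snake_squares (~~ d) (x + k.-1) y a)) =
    [&& (x <= u)%N, (y <= v)%N, (u - x + (v - y) <= k.-1)%N
      & (v - y == d * (u - x + (v - y)))%N] ||
    ((u, v) \in (if d then snake_squares (~~ d) x (y + k.-1) a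
                 else snake_squares (~~ d) (x + k.-1) y a)).
  rewrite mem_cat; congr (_ || _); apply/mapP/idP => [[i]|].
    by rewrite mem_iota => ik; case: d {IH m} => -[-> ->]; lia.
  move=> uv; exists (u - x + (v - y))%N; first by rewrite mem_iota; lia.
  by case: d {IH m} uv => uv; congr pair; lia.
rewrite height_nseq_cat size_cat size_nseq.
have [a_nil|a_cons] := eqVneq a [::].
  have -> : m = [::] by rewrite /m a_nil.
  rewrite a_nil addn0 /height /= addn0.
  by case: d {IH m}; rewrite /= ?in_nil orbF ?mul1n ?mul0n; case: ifP; lia.
have m0 : height m 0 = 0%N by rewrite /height take0.
have mle j : (height m j <= j)%N.
  by rewrite /height (leq_trans (count_size _ _)) // size_take_min geq_minl.
have {}IH x' y' := IH (~~ d) x' y' a0 a_cons; rewrite -/m in IH.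
case: d @m m0 mle IH => m m0 mle IH; rewrite IH.
- have := mle (u - x + (v - y) - k.-1)%N.
  case: (leqP (y + k.-1) v) => yv; last by case: ifP; lia.
  have -> : (u - x + (v - (y + k.-1)) = u - x + (v - y) - k.-1)%N by lia.
  case: ifP => [N|]; last by lia.
  by move: N; rewrite -subn_eq0 => /eqP N; rewrite N m0; lia.
- have := mle (u - x + (v - y) - k.-1)%N.
  case: (leqP (x + k.-1) u) => yv; last by case: ifP; lia.
  have -> : (u - (x + k.-1) + (v - y) = u - x + (v - y) - k.-1)%N by lia.
  case: ifP => [N|]; last by lia.
  by move: N; rewrite -subn_eq0 => /eqP N; rewrite N m0; lia.
Qed.

(* (x, y) is the lower left corner of a square between L and U when, on the
   antidiagonal x + y + 1 through the middle of that square, L is at its lower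
   right corner or below and U is at its upper left corner or above. *)
Lemma snake_diagramP (a : seq nat) (x y : nat) :
  all (leq 1) a -> a != [::] ->
  ((x, y) \in snake_squares false 0 0 a) =
  [&& (x + y < (size (snake_upper a)).-1)%N,
      (height (snake_lower a) (x + y).+1 <= y)%N
    & (y < height (snake_upper a) (x + y).+1)%N].
Proof.
move=> a1 a0; rewrite snake_squaresP // !subn0 !leq0n /=.
rewrite size_rcons ltnS; case: (leqP (x + y)) => //= xy.
by rewrite !height_cons !height_rcons //=; lia.
Qed.

(* Main.v *)
Require Import Defs.
From mathcomp Require Import finmap boolp classical_sets functions cardinality.
From mathcomp Require Import all_boot all_order all_algebra reals.
From mathcomp Require Import zify ring.

(* In terms of the partial sums of its points, measured from the lower path, the
   polytope of a snake with N squares is the order polytope of a fence, a poset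
   whose Hasse diagram is a path with N vertices. Its Ehrhart function at t
   counts the monotone maps z from the fence to {0, ..., t}.

   For S(a, b) the fence has a maximum above two disjoint chains with p = a - 1
   and q = b - 1 elements; summing over the value v of the maximum gives
   \sum_v C(v + p, p) C(v + q, q), so that h*_i = C(p, i) C(q, i).

   For S(a, ..., a) the fence is graded, with rank function rho, and the proof
   follows Branden: s = 2 z + rho maps z to a strictly monotone map such that
   s x and rho x have the same parity. Grouping the values of s into maximal
   runs of equal parity decomposes the generating function of these maps into
   products of powers of z and Eulerian polynomials, all of which are
   gamma-positive with the same center of symmetry. *)

Set Implicit Arguments.
Unset Strict Implicit.
Unset Printing Implicit Defensive.

Import Order.TTheory GRing.Theory Num.Theory.

Local Open Scope ring_scope.

(** * Gamma-positive polynomials *)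

(* The generators are the z^i (1 + z)^(e - 2 i), where e = k - l is the sum of
   the lowest and highest degrees; it is given by two indices in order to avoid
   truncated subtractions. *)
Inductive gamma_pos (k l : nat) : {poly int} -> Prop :=
| GammaPos0 : gamma_pos k l 0
| GammaPosD p q : gamma_pos k l p -> gamma_pos k l q -> gamma_pos k l (p + q)
| GammaPosGen i d : (i.*2 + d + l = k)%N ->
    gamma_pos k l ('X^i * (1 + 'X) ^+ d).

Lemma gamma_pos_sum (k l : nat) (I : finType) (P : pred I) (F : I -> {poly
  int}) :
  (forall i, P i -> gamma_pos k l (F i)) -> gamma_pos k l (\sum_(i | P i) F i).
Proof.
move=> FP; elim/big_ind: _ => //; first exact: GammaPos0.
exact: GammaPosD.
Qed.

Lemma gamma_posMn (k l n : nat) (p : {poly int}) :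
  gamma_pos k l p -> gamma_pos k l (p *+ n).
Proof.
move=> pP; elim: n => [|n IH]; first by rewrite mulr0n; apply: GammaPos0.
by rewrite mulrS; apply: GammaPosD.
Qed.

Lemma gamma_posW (k l k' l' : nat) (p : {poly int}) :
  (k + l' = k' + l)%N -> gamma_pos k l p -> gamma_pos k' l' p.
Proof.
move=> kl; elim=> [|p1 p2 _ + _|i d ik]; first exact: GammaPos0.
  exact: GammaPosD.
by apply: GammaPosGen; lia.
Qed.

Lemma gamma_posM (k l k' l' : nat) (p q : {poly int}) :
  gamma_pos k l p -> gamma_pos k' l' q -> gamma_pos (k + k') (l + l') (p * q).
Proof.
move=> pP qP; elim: pP => [|p1 p2 _ P1 _ P2|i d ik].
- by rewrite mul0r; apply: GammaPos0.
- by rewrite mulrDl; apply: GammaPosD.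
elim: qP => [|q1 q2 _ Q1 _ Q2|j e je].
- by rewrite mulr0; apply: GammaPos0.
- by rewrite mulrDr; apply: GammaPosD.
rewrite mulrACA -!exprD; apply: GammaPosGen; lia.
Qed.

Lemma gamma_pos1 : gamma_pos 0 0 1.
Proof. by rewrite -[1](mulr1 1); apply: (@GammaPosGen 0 0 0 0). Qed.

Lemma gamma_posX : gamma_pos 2 0 'X.
Proof. by rewrite -['X](mulr1 'X); apply: (@GammaPosGen 2 0 1 0). Qed.

Lemma bin_rise (n k : nat) : (k.*2 < n)%N -> ('C(n, k) <= 'C(n, k.+1))%N.
Proof.
move=> kn; have := mul_bin_left n k => E.
by rewrite -(leq_pmul2l (ltn0Sn k)) E leq_mul2r; apply/orP; right; lia.
Qed.

Lemma coef_gamma_gen (i d j : nat) :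
  ('X^i * (1 + 'X) ^+ d : {poly int})`_j =
  if (j < i)%N then 0 else ('C(d, j - i))%:Z.
Proof.
rewrite coefXnM; case: ltnP => // ij.
rewrite addrC; rewrite exprD1n coef_sum.
under eq_bigr do rewrite coefMn coefXn.
case: (ltnP (j - i) d.+1) => jd.
  rewrite (bigD1 (Ordinal jd)) //= eqxx big1 ?addr0 ?natz //= => k kn.
  case: eqP => [e|]; rewrite ?mul0rn //.
  by case/eqP: kn; apply: val_inj.
rewrite bin_small // big1 //= => k _.
by case: eqP => [e|]; rewrite ?mul0rn //; have := ltn_ord k; lia.
Qed.

(** All four properties survive sums, so only the generators matter: z^i (1 + z)^d with 2 i + d = e
    carries a binomial row centered at e / 2. *)
Lemma gamma_pos_coef (k l e : nat) (p : {poly int}) :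
  (e + l = k)%N -> gamma_pos k l p ->
  [/\ forall j, 0 <= p`_j,
      forall j, (j <= e)%N -> p`_(e - j) = p`_j,
      forall j, (e < j)%N -> p`_j = 0
    & forall j, (j.*2 < e)%N -> p`_j <= p`_j.+1].
Proof.
move=> ek; elim=> [|p1 p2 _ [a1 b1 c1 d1] _ [a2 b2 c2 d2]|i d idk].
- by split=> *; rewrite !coef0.
- split=> j *; rewrite !coefD.
  + exact: addr_ge0.
  + by rewrite b1 ?b2.
  + by rewrite c1 ?c2.
  + by rewrite lerD ?d1 ?d2.
- split=> j; rewrite !coef_gamma_gen.
  + by case: ifP.
  + move=> je; case: ifP; case: ifP => // ji eji.
    * by rewrite bin_small //; lia.
    * by rewrite bin_small //; lia.
    * by rewrite -bin_sub; [congr (Posz (binomial _ _)); lia|lia].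
  + by move=> ej; case: ifP => // _; rewrite bin_small //; lia.
  + move=> je; case: ifP; case: ifP => // ji ji'; first by lia.
    rewrite lez_nat subSn; last by lia.
    by apply: bin_rise; lia.
Qed.

(** The Eulerian polynomial counting permutations of n elements by descents, through its
    differential recurrence. *)
Fixpoint euler (n : nat) : {poly int} :=
  if n is m.+1 then
    if m is 0 then 1 else (1 + 'X *+ m) * euler m + 'X * (1 - 'X) * (euler
      m)^`()
  else 1.

Lemma eulerS (m : nat) :
  euler m.+1 = (1 + 'X *+ m) * euler m + 'X * (1 - 'X) * (euler m)^`().
Proof. by case: m => //=;
  rewrite -polyC1 derivC !mulr0 mulr0n !addr0 mulr1. Qed.

(** The Eulerian recurrence maps a generator to a nonnegative combination of generators whose degree
    sum is one larger. For d = 0 the truncated [d.-1] is harmless, its coefficient being 0. *)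
Lemma euler_step (i d : nat) (p : {poly int} := 'X^i * (1 + 'X) ^+ d) :
  (1 + 'X *+ (i.*2 + d).+1) * p + 'X * (1 - 'X) * p^`() =
  ('X^i * (1 + 'X) ^+ d.+1) *+ i.+1 + ('X^(i.+1) * (1 + 'X) ^+ d.-1) *+ d.*2.
Proof.
rewrite -!addnn /p derivM derivXn deriv_exp derivD -polyC1 derivC derivX.
rewrite add0r polyC1 mul1r.
by case: i {p} => [|i]; case: d => [|d]; rewrite /= ?exprS ?expr0; ring.
Qed.

Lemma gamma_pos_euler (n : nat) : gamma_pos n.+1 1 (euler n.+1).
Proof.
elim: n => [|n IH].
  by rewrite -[euler 1](mulr1 1); apply: (@GammaPosGen 1 1 0 0).
rewrite eulerS; elim: IH => [|p1 p2 _ P1 _ P2|i d idn].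
- by rewrite deriv0 !mulr0 addr0; apply: GammaPos0.
- by rewrite derivD 2!(mulrDr _ p1, mulrDr _ p1^`()) addrACA; apply: GammaPosD.
(* The multiplier in the recurrence is one more than the degree sum of the generator, as
   [euler_step] requires. *)
rewrite (_ : n.+1 = (i.*2 + d).+1) ?euler_step; last by lia.
apply: GammaPosD; first by apply: gamma_posMn; apply: GammaPosGen; lia.
case: d idn => [|d] idn; first by rewrite mulr0n; apply: GammaPos0.
by apply: gamma_posMn; apply: GammaPosGen; lia.
Qed.

(** * Eulerian polynomials and power series *)

(** The numerator over (1 - z)^(n+1) of the generating function of t^n, with 0^0 = 1; [euler n] is
    that of (t + 1)^n. *)
Definition eulerX (n : nat) : {poly int} := if n is 0 then 1 else 'X * euler n.

(** This is z d/dz applied to [eulerX n] / (1 - z)^(n+1). *)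
Lemma eulerXS (n : nat) :
  eulerX n.+1 = 'X * (1 - 'X) * (eulerX n)^`() + ('X * eulerX n) *+ n.+1.
Proof.
case: n => [|n]; first by rewrite /= -polyC1 derivC polyC1; ring.
by rewrite /eulerX eulerS derivM derivX; ring.
Qed.

(* The binomial theorem for [(t + 1) ^ n], read on generating functions. *)
Lemma euler_eulerX (n : nat) :
  euler n = \sum_(b < n.+1) ((1 - 'X) ^+ (n - b) * eulerX b) *+ 'C(n, b).
Proof.
elim: n => [|n IH]; first by rewrite big_ord1 /= mul1r.
pose t m b : {poly int} := ((1 - 'X) ^+ (m - b) * eulerX b) *+ 'C(m, b).
pose u b : {poly int} := ((1 - 'X) ^+ (n - b) * eulerX b.+1) *+ 'C(n, b).
have dt b : (b <= n)%N -> 'X * (1 - 'X) * (t n b)^`() =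
    u b - ('X * t n b) *+ n.+1.
  rewrite /t /u eulerXS derivMn derivM deriv_exp derivB -polyC1 derivC derivX.
  rewrite polyC1 => bn.
  have -> : n.+1 = ((n - b) + b.+1)%N by lia.
  by case: (n - b)%N => [|m]; rewrite /= ?exprS ?expr0; ring.
have {}IH : euler n = \sum_(b < n.+1) t n b by [].
rewrite eulerS IH linear_sum [X in _ + X]mulr_sumr.
rewrite [X in _ + X](eq_bigr _ (fun (b : ordinal _) _ => dt b (leq_ord b))).
rewrite sumrB sumrMnl -mulr_sumr.
have -> (p q : {poly int}) : (1 + 'X *+ n) * p + (q - ('X * p) *+ n.+1) =
    (1 - 'X) * p + q by ring.
rewrite -[RHS]/(\sum_(b < n.+2) t n.+1 b) [RHS]big_ord_recl mulr_sumr.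
rewrite [X in X + _ = _]big_ord_recl -addrA; congr (_ + _).
  by rewrite /t !bin0 !mulr1n !subn0 exprS mulrA.
(* [v] and [u] are the two halves of the terms of index b + 1 under Pascal's rule. *)
pose v b : {poly int} := ((1 - 'X) ^+ (n - b) * eulerX b.+1) *+ 'C(n, b.+1).
have -> : \sum_(i < n) (1 - 'X) * t n (lift ord0 i) = \sum_(b < n.+1) v b.
  rewrite [RHS]big_ord_recr /= /v bin_small // mulr0n addr0.
  apply: eq_bigr => i _; rewrite /t /bump add1n mulrnAr mulrA -exprS.
  by congr (_ ^+ _ * _ *+ _); have := ltn_ord i; lia.
rewrite -big_split; apply: eq_bigr => b _ /=.
by rewrite /t /u /v /bump add1n subSS binS -mulrnDr.
Qed.

(* [ser k p] is the coefficient sequence of the power series p / (1 - z)^k. *)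
Fixpoint ser (k : nat) (p : {poly int}) (t : nat) : int :=
  if k is k'.+1 then \sum_(i < t.+1) ser k' p i else p`_t.

Lemma ser0 (k t : nat) : ser k 0 t = 0.
Proof.
elim: k t => [|k IH] t /=; first by rewrite coef0.
by rewrite big1.
Qed.

Lemma serD (k : nat) (p q : {poly int}) (t : nat) :
  ser k (p + q) t = ser k p t + ser k q t.
Proof.
elim: k t => [|k IH] t /=; first by rewrite coefD.
by rewrite -big_split; apply: eq_bigr.
Qed.

Lemma serZ (k : nat) (a : int) (p : {poly int}) (t : nat) :
  ser k (a *: p) t = a * ser k p t.
Proof.
elim: k t => [|k IH] t /=; first by rewrite coefZ.
by rewrite mulr_sumr; apply: eq_bigr.
Qed.

Lemma serB (k : nat) (p q : {poly int}) (t : nat) :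
  ser k (p - q) t = ser k p t - ser k q t.
Proof. by rewrite -scaleN1r serD serZ mulN1r. Qed.

Lemma ser_sum (k : nat) (I : Type) (r : seq I) (P : pred I)
    (F : I -> {poly int}) (t : nat) :
  ser k (\sum_(i <- r | P i) F i) t = \sum_(i <- r | P i) ser k (F i) t.
Proof.
elim/big_rec2: _ => [|i y x _ <-]; first by rewrite ser0.
by rewrite serD.
Qed.

Lemma serS (k : nat) (p : {poly int}) (t : nat) :
  ser k.+1 p t.+1 = ser k.+1 p t + ser k p t.+1.
Proof. by rewrite /= big_ord_recr. Qed.

Lemma ser_mulX0 (k : nat) (p : {poly int}) : ser k ('X * p) 0 = 0.
Proof.
elim: k => [|k IH] /=; first by rewrite coefXM.
by rewrite big_ord1.
Qed.

Lemma ser_mulX (k : nat) (p : {poly int}) (t : nat) :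
  ser k ('X * p) t.+1 = ser k p t.
Proof.
elim: k t => [|k IH] t; first by rewrite /= coefXM.
by rewrite /= big_ord_recl ser_mulX0 add0r; apply: eq_bigr => i _; apply: IH.
Qed.

Lemma ser_mul1BX (k : nat) (p : {poly int}) (t : nat) :
  ser k.+1 ((1 - 'X) * p) t = ser k p t.
Proof.
have -> : (1 - 'X) * p = p - 'X * p by ring.
rewrite serB; case: t => [|t]; first by rewrite ser_mulX0 subr0 /= big_ord1.
by rewrite ser_mulX serS; ring.
Qed.

Lemma ser_exp1BX (k n : nat) (p : {poly int}) (t : nat) :
  ser (n + k) ((1 - 'X) ^+ n * p) t = ser k p t.
Proof.
elim: n => [|n IH]; first by rewrite mul1r.
by rewrite exprS -mulrA addSn ser_mul1BX.
Qed.

Lemma ser_Xn (k j t : nat) : (j <= k)%N -> ser k.+1 'X^j t = 'C(t + k - j,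
  k)%:Z.
Proof.
move=> jk.
(* The explicit case t < j replaces the truncated subtraction, so that the induction can run without
   assuming j <= k. *)
suff {t k jk} H k t : ser k.+1 'X^j t =
    if (t < j)%N then 0 else ('C(t - j + k, k))%:Z.
  rewrite H; case: ltnP => tj; last by congr (Posz (binomial _ _)); lia.
  by rewrite bin_small //; lia.
elim: k t => [|k IH] t /=.
  have E i : ('X^j : {poly int})`_i = (i == j)%:R by rewrite coefXn.
  under eq_bigr do rewrite E.
  case: ltnP => tj.
    by rewrite big1 // => i _; case: eqP => // e; have := ltn_ord i; lia.
  rewrite -ltnS in tj; rewrite (bigD1 (Ordinal tj)) //= eqxx big1 => [|i ij].
    by rewrite addr0 bin0.
  by rewrite -(inj_eq val_inj) /= in ij; rewrite (negbTE ij).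
under eq_bigr => i _ do rewrite -/(ser k.+1 _ _) IH.
elim: t => [|t IHt].
  rewrite big_ord1; case: ltnP => //; rewrite leqn0 => /eqP ->.
  by rewrite !binn.
rewrite big_ord_recr /= IHt; case: (ltngtP t.+1 j) => tj.
- by [].
- by rewrite subSn // -PoszD !addnS addSn binS.
- by rewrite tj subnn !add0n !binn.
Qed.

Lemma ser_binE (k : nat) (p : {poly int}) (t : nat) : (size p <= k.+1)%N ->
  ser k.+1 p t = \sum_(j < k.+1) p`_j * ('C(t + k - j, k))%:Z.
Proof.
move=> sp; rewrite -{1}(take_poly_id sp) /take_poly poly_def ser_sum.
by apply: eq_bigr => j _; rewrite serZ ser_Xn // -ltnS.
Qed.

(** Initial zeros pass from partial sums to their differences, once for each factor 1 / (1 - z). *)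
Lemma ser_eq0_coef (k g : nat) (p : {poly int}) :
  (forall t, (t < g)%N -> ser k p t = 0) -> forall t, (t < g)%N -> p`_t = 0.
Proof.
elim: k => [//|k IH] H; apply: IH => t tg.
case: t tg => [|t] tg; first by have := H 0%N tg; rewrite /= big_ord1.
by have := H _ tg; rewrite serS H 1?ltnW // add0r.
Qed.

(** * The order polynomial of a graded poset *)

Lemma sum_subset_card (V : finType) (K : nzRingType) (C : {set V}) (w : nat ->
  K) :
  \sum_(B : {set V} | B \subset C) w #|B| =
  \sum_(i < #|C|.+1) w i *+ 'C(#|C|, i).
Proof.
pose f (B : {set V}) : 'I_#|C|.+1 := inord #|B|.
rewrite (partition_big f xpredT) //=; apply: eq_bigr => i _.
rewrite -cards_draws -sumr_const; apply: eq_big => [B|B /andP[BC /eqP <-]].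
  rewrite inE; case: (boolP (B \subset C)) => //= BC.
  by rewrite -(inj_eq val_inj) /= inordK // ltnS subset_leq_card.
by rewrite inordK // ltnS subset_leq_card.
Qed.

(** * Peeling off maximal elements by rank parity *)

Section GradedPoset.
Variables (V : finType) (rho : V -> nat) (R : rel V).
Hypothesis rhoS : forall x y, R x y -> rho y = (rho x).+1.

(** The elements that may receive the largest value of a strictly monotone map on [S], when that
    value has parity [p]. *)
Definition avail (p : bool) (S : {set V}) : {set V} :=
  [set x in S | (odd (rho x) == p) && [forall y in S, ~~ R x y]].

Lemma availP (p : bool) (S : {set V}) (x : V) :
  reflect [/\ x \in S, odd (rho x) = p & forall y, y \in S -> ~~ R x y]
          (x \in avail p S).
Proof.
rewrite inE; apply: (iffP and3P) => -[xS xp xR]; split=> //.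
- exact/eqP.
- by move=> y yS; move/forall_inP: xR; apply.
- exact/eqP.
- by apply/forall_inP.
Qed.

Lemma avail_sub (p : bool) (S C : {set V}) : C \subset avail p S -> C \subset S.
Proof. by move/subset_trans; apply; apply/subsetP => x /availP[]. Qed.

(** Removing [C] frees only predecessors of elements of [C], and their rank has the other parity. *)
Lemma availD (p : bool) (S C : {set V}) :
  C \subset avail p S -> avail p (S :\: C) = avail p S :\: C.
Proof.
move=> CS; apply/setP => x; rewrite [in RHS]inE.
apply/availP/andP => [[]|[xC /availP[xS xp xR]]].
  rewrite inE => /andP[xC xS] xp xR; split=> //; apply/availP; split=> // y yS.
  case: (boolP (y \in C)) => [yC|yC]; last by apply: xR; rewrite inE yC.
  have /availP[_ yp _] := subsetP CS _ yC.
  by apply/negP => /rhoS e; move: yp; rewrite e /= xp; case: p {CS xp}.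
split; rewrite ?inE ?xC //.
by move=> y; rewrite inE => /andP[_ /xR].
Qed.

Definition peel (K : nzRingType) (p : bool) (u : nat -> K) (f : {set V} -> K)
    (S : {set V}) : K :=
  \sum_(C : {set V} | C \subset avail p S) u #|C| * f (S :\: C).

Lemma eq_peel (K : nzRingType) (p : bool) (u v : nat -> K)
    (f g : {set V} -> K) (S : {set V}) :
  u =1 v -> f =1 g -> peel p u f S = peel p v g S.
Proof. by move=> uv fg; apply: eq_bigr => C _; rewrite uv fg. Qed.

(** By [availD], peeling twice with the same parity removes one available set [C], split into an
    arbitrary part and its complement. Hence the weights combine by binomial convolution. *)
Lemma peel_comp (K : nzRingType) (p : bool) (u v : nat -> K)
    (f : {set V} -> K) (S : {set V}) :
  peel p u (peel p v f) S =
  peel p (fun n => \sum_(i < n.+1) (u i * v (n - i)%N) *+ 'C(n, i)) f S.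
Proof.
rewrite /peel.
transitivity (\sum_(B : {set V} | B \subset avail p S)
   \sum_(C : {set V} | (C \subset avail p S) && (B \subset C))
     u #|B| * v (#|C| - #|B|)%N * f (S :\: C)).
  apply: eq_bigr => B BS; rewrite mulr_sumr.
  (* The new variable is the union of the two peeled sets. *)
  rewrite (reindex_onto (fun C => C :\: B) (fun C => B :|: C)) /=; last first.
    move=> C; rewrite availD // subsetD => /andP[_ CB].
    by rewrite setDUl setDv set0U; apply/setDidPl.
  apply: eq_big => [C|C].
    rewrite availD //; apply/andP/andP => -[].
      rewrite subsetD => /andP[CS _] /eqP CB; rewrite -CB subsetUl; split=> //.
      by rewrite subUset BS.
    move=> CS BC; split; first exact: setSD.
    apply/eqP/setP => x; rewrite !inE; case: (boolP (x \in B)) => //=.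
    by move/(subsetP BC) ->.
  case/andP=> _ /eqP CB; rewrite mulrA; congr (_ * _ * f _).
    by rewrite cardsD (setIidPr _) // -CB subsetUl.
  by rewrite setDDl CB.
rewrite (exchange_big_dep (fun C : {set V} => C \subset avail p S)) /=;
  last first.
  by move=> B C _ /andP[].
apply: eq_bigr => C CS; rewrite -mulr_suml; congr (_ * _).
rewrite -(sum_subset_card C (fun i => u i * v (#|C| - i)%N)).
apply: eq_bigl => B; rewrite CS /=.
by apply: andb_idl => /subset_trans; apply.
Qed.

Lemma peel_set0 (K : nzRingType) (p : bool) (u : nat -> K) (f : {set V} -> K)
    (S : {set V}) :
  peel p u f S = u 0%N * f S +
  \sum_(C : {set V} | (C \subset avail p S) && (C != set0)) u #|C| * f (S :\:
    C).
Proof. by rewrite /peel (bigD1 set0) ?sub0set //= cards0 setD0. Qed.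

(** Eulerian weights that forbid an empty block. *)
Definition Xw (n : nat) : {poly int} := if n is 0 then 0 else euler n.

Definition dirac0 (S : {set V}) : {poly int} := (S == set0)%:R.

Lemma peel_euler (p : bool) (f : {set V} -> {poly int}) (S : {set V}) :
  peel p euler f S = f S + peel p Xw f S.
Proof.
rewrite !peel_set0 mul1r mul0r add0r; congr (_ + _); apply: eq_bigr => C.
by rewrite -card_gt0; case: #|C| => [|n]; rewrite ?andbF.
Qed.

Lemma peel_eulerX (p : bool) (f : {set V} -> {poly int}) (S : {set V}) :
  peel p eulerX f S = f S + 'X * peel p Xw f S.
Proof.
rewrite !peel_set0 mul1r mul0r add0r mulr_sumr; congr (_ + _).
apply: eq_bigr => C; rewrite -card_gt0.
by case: #|C| => [|n]; rewrite ?andbF //= mulrA.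
Qed.

(* With U = peel (1 - z)^n and X = peel Xw, this is U (1 + z X) = 1 + X. *)
Lemma peel_exp1BX (p : bool) (f : {set V} -> {poly int}) (S : {set V}) :
  peel p (fun n => (1 - 'X) ^+ n) (peel p eulerX f) S = peel p euler f S.
Proof.
rewrite peel_comp; apply: eq_peel => // n.
rewrite euler_eulerX [RHS](reindex_inj rev_ord_inj) /=.
apply: eq_bigr => i _; have := ltn_ord i; rewrite ltnS subSS => le_in.
by rewrite subKn // bin_sub.
Qed.

(* Generating polynomials of the ordered partitions of [S] into nonempty
   blocks of alternating parity, with the last block of parity [p]; a factor
   [z] marks each passage from an odd block to the next, even one. *)
Fixpoint block_poly_rec (n : nat) (p : bool) (S : {set V}) : {poly int} :=
  if n is n'.+1 then
    peel p Xw (fun S' => dirac0 S' + 'X^(~~ p) * block_poly_rec n' (~~ p) S') S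
  else 0.

Definition block_poly := block_poly_rec #|V|.

(** Each block is nonempty, so at most [#|S|] recursive calls contribute and further fuel changes
    nothing. *)
Lemma block_poly_recS (n : nat) (p : bool) (S : {set V}) :
  (#|S| <= n)%N -> block_poly_rec n.+1 p S = block_poly_rec n p S.
Proof.
elim: n p S => [|n IH] p S Sn.
  rewrite /= peel_set0 mul0r add0r big1 // => C /andP[/avail_sub CS].
  by rewrite -card_gt0; have := subset_leq_card CS; lia.
rewrite [LHS]/= [RHS]/= !peel_set0 !mul0r; congr (_ + _).
apply: eq_bigr => C /andP[/avail_sub CS]; rewrite -card_gt0 => C0.
rewrite -[peel _ _ _ _]/(block_poly_rec n.+1 (~~ p) (S :\: C)) IH //.
by rewrite cardsDS //; lia.
Qed.

Lemma block_polyE (p : bool) (S : {set V}) :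
  block_poly p S =
  peel p Xw (fun S' => dirac0 S' + 'X^(~~ p) * block_poly (~~ p) S') S.
Proof. by rewrite /block_poly -block_poly_recS // max_card. Qed.

(** The terms stand for the empty partition and for the two parities of the last block.
    [parity_count_ser] identifies the counting function behind this numerator. *)
Definition order_poly (S : {set V}) : {poly int} :=
  dirac0 S + block_poly false S + block_poly true S.

(* After division by (1 - z)^(#|S| + 1), this is the recurrence satisfied by the
   generating function of the parity maps, two values being peeled at a time. *)
Lemma order_polyE (S : {set V}) :
  order_poly S = peel true (fun n => (1 - 'X) ^+ n)
    (peel false (fun n => (1 - 'X) ^+ n)
      (fun S' => (1 - 'X) * dirac0 S' + 'X * order_poly S')) S.
Proof.
pose f0 S := dirac0 S + 'X * block_poly true S.
pose f1 S := dirac0 S + block_poly false S.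
have b0 S' : block_poly false S' = peel false Xw f0 S' by rewrite block_polyE.
have b1 S' : block_poly true S' = peel true Xw f1 S'.
  by rewrite block_polyE; apply: eq_peel => // T; rewrite expr0 mul1r.
(* Once the inner function is [peel true eulerX f1], [peel_exp1BX] turns the whole into
   [peel true euler f1], that is, [f1] plus [block_poly true]. The even layer is treated in the same
   way with [f0]. *)
rewrite (@eq_peel _ true _ (fun n => (1 - 'X) ^+ n) _ (peel true eulerX f1)) //.
  by rewrite peel_exp1BX peel_euler -b1.
move=> T; rewrite (@eq_peel _ false _ (fun n => (1 - 'X) ^+ n) _
                           (peel false eulerX f0)) //.
  by rewrite peel_exp1BX peel_euler peel_eulerX -b0 -b1 /f0 /f1; ring.
by move=> U; rewrite peel_eulerX -b0 /f0 /order_poly; ring.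
Qed.

(** The weight (1 - z)^|C| makes up exactly for the drop from |S| to |S \ C| in the exponent of the
    denominator, leaving weight 1. *)
Lemma ser_peel (p : bool) (k t : nat) (f : {set V} -> {poly int}) (S : {set V})
  :
  ser (#|S| + k) (peel p (fun n => (1 - 'X) ^+ n) f S) t =
  peel p (fun=> 1) (fun S' => ser (#|S'| + k) (f S') t) S.
Proof.
rewrite /peel ser_sum; apply: eq_bigr => C /avail_sub CS.
rewrite mul1r -[RHS](ser_exp1BX _ #|C|) addnA cardsDS // subnKC //.
exact: subset_leq_card.
Qed.

(* The maps [s] with [s x] of the parity of [rho x] which strictly increase
   along [R]; outside of [S] they take the dummy value 0. *)
Definition parity_map (K : nat) (S : {set V}) (M : nat)
    (s : {ffun V -> 'I_K.+1}) : bool :=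
  [forall x, if x \in S then (s x < M)%N && (odd (s x) == odd (rho x))
             else s x == ord0] &&
  [forall x in S, [forall y in S, R x y ==> (s x < s y)%N]].

Definition parity_count (K : nat) (S : {set V}) (M : nat) : nat :=
  #|[set s | parity_map (K := K) S M s]|.

Lemma parity_mapP (K : nat) (S : {set V}) (M : nat) (s : {ffun V -> 'I_K.+1}) :
  reflect [/\ forall x, x \in S -> (s x < M)%N /\ odd (s x) = odd (rho x),
              forall x, x \notin S -> s x = ord0
            & forall x y, x \in S -> y \in S -> R x y -> (s x < s y)%N]
          (parity_map S M s).
Proof.
apply: (iffP andP) => [[/forallP H1 /forall_inP H2]|[H1 H2 H3]]; split.
- by move=> x xS; have := H1 x; rewrite xS => /andP[? /eqP].
- by move=> x /negbTE xS; have := H1 x; rewrite xS => /eqP.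
- by move=> x y xS yS; move: (H2 x xS) => /forall_inP/(_ y yS)/implyP.
- apply/forallP => x; case: ifPn => [/H1[-> ->]|/H2 ->] //=.
- by apply/forall_inP => x xS; apply/forall_inP => y yS; apply/implyP;
  apply: H3.
Qed.

Lemma parity_count0 (K : nat) (S : {set V}) :
  parity_count K S 0 = (S == set0).
Proof.
have [->|/set0Pn[x xS]] := eqVneq S set0; last first.
  apply/eqP; rewrite cards_eq0; apply/eqP/setP => s; rewrite !inE.
  by apply/negP => /parity_mapP[/(_ x xS)[]].
apply/eqP/cards1P; exists [ffun=> ord0]; apply/setP => s; rewrite !inE.
apply/parity_mapP/eqP => [[_ H _]|->].
  by apply/ffunP => x; rewrite ffunE H // inE.
by split=> [x|x _|x y]; rewrite ?inE // ffunE.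
Qed.

(** Classify the maps by the set [C] of elements with the top value [M]; what remains is a parity
    map on [S :\: C] with values below [M]. *)
Lemma parity_countS (K : nat) (S : {set V}) (M : nat) : (M <= K)%N ->
  parity_count K S M.+1 =
  (\sum_(C : {set V} | C \subset avail (odd M) S) parity_count K (S :\: C) M)%N.
Proof.
move=> MK; rewrite /parity_count -sum1_card.
pose top (s : {ffun V -> 'I_K.+1}) := [set x in S | s x == M :> nat].
rewrite (partition_big top (fun C => C \subset avail (odd M) S)) /=; last first.
  move=> s; rewrite inE => /parity_mapP[sM _ sR].
  apply/subsetP => x; rewrite inE => /andP[xS /eqP sx].
  have [_ px] := sM x xS; apply/availP; split=> // [|y yS];
    first by rewrite -px sx.
  by apply/negP => /(sR _ _ xS yS); have [] := sM y yS; lia.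
apply: eq_bigr => C CS; have CsubS := subsetP (avail_sub CS).
(* [put] and [drop] exchange the top value on [C] with the dummy value 0. *)
pose put (s : {ffun V -> 'I_K.+1}) :=
  [ffun x => if x \in C then inord M else s x].
pose drop (s : {ffun V -> 'I_K.+1}) := [ffun x => if x \in C then ord0 else s
  x].
have vM : (inord M : 'I_K.+1) = M :> nat by rewrite inordK.
rewrite (reindex_onto put drop) /=; last first.
  move=> s /andP[_ /eqP tC]; apply/ffunP => x; rewrite !ffunE.
  case: (boolP (x \in C)) => // xC; apply: ord_inj; rewrite vM.
  by move: xC; rewrite -tC inE => /andP[_ /eqP].
rewrite -sum1_card; apply: eq_bigl => s; rewrite !inE.
apply/andP/parity_mapP => [[/andP[/parity_mapP[H1 H2 H3] /eqP tC] /eqP dS]|].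
  have sC x : x \in C -> s x = ord0 by move=> xC; rewrite -dS ffunE xC.
  split=> [x|x|x y]; rewrite ?inE.
  - case/andP=> xC xS; have := H1 x xS; rewrite ffunE (negbTE xC) => -[sM ps].
    split=> //; suff : s x != M :> nat by lia.
    by move: xC; rewrite -tC inE xS ffunE; case: ifP => // /sC ->;
      rewrite vM eqxx.
  - rewrite negb_and negbK => /orP[/sC //|xS].
    have := H2 x xS; rewrite ffunE; case: ifP => // xC.
    by rewrite (CsubS _ xC) in xS.
  - case/andP=> xC xS /andP[yC yS] /H3 - /(_ xS yS).
    by rewrite !ffunE (negbTE xC) (negbTE yC).
case=> H1 H2 H3; have sC x : x \in C -> s x = ord0.
  by move=> xC; apply: H2; rewrite inE xC.
split; last first.
  by apply/eqP/ffunP => x; rewrite !ffunE; case: ifPn => [/sC ->|/negbTE ->].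
apply/andP; split; last first.
  apply/eqP/setP => x; rewrite inE ffunE; case: ifP => [xC|/negbT xC].
    by rewrite vM eqxx CsubS.
  apply/negP => /andP[xS /eqP sx].
  by have [] := H1 x _; rewrite ?inE ?xC // sx ltnn.
apply/parity_mapP; split=> [x xS|x xS|x y xS yS xy]; rewrite !ffunE.
- case: ifPn => xC; last by have [|? ?] := H1 x; rewrite ?inE ?xC // ltnW.
  by rewrite vM; split=> //; have /availP[] := subsetP CS _ xC.
- by rewrite ifN ?H2 ?inE ?(negbTE xS) ?andbF //; apply: contra xS => /CsubS.
- case: ifPn => xC.
    by have /availP[_ _ /(_ y yS)] := subsetP CS _ xC; rewrite xy.
  have xM : (s x < M)%N by have [] := H1 x; rewrite ?inE ?xC.
  by case: ifPn => yC; [rewrite vM|apply: H3; rewrite ?inE ?xC ?yC].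
Qed.

(** The odd value 2 t + 1 and then the even value 2 t are peeled, matching the two layers of
    [order_polyE]. *)
Lemma parity_count_ser (K t : nat) (S : {set V}) : (t.*2.+1 <= K)%N ->
  (parity_count K S t.*2.+2)%:Z = ser #|S|.+1 (order_poly S) t.
Proof.
elim: t S => [|t IH] S tK; rewrite -[X in ser X]addn1 order_polyE !ser_peel.
all: rewrite -natz parity_countS // oddS odd_double natr_sum;
  apply: eq_bigr => C _.
all: lazy beta; rewrite ser_peel mul1r parity_countS 1?ltnW // natr_sum.
all: rewrite odd_double; apply: eq_bigr => D _; rewrite mul1r.
all: set T := (_ :\: D); rewrite addn1 serD ser_mul1BX.
  (* At t = 0 no value is left, so only the empty set admits a map; the term (1 - z) [dirac0]
     accounts for it and vanishes at later t. *)
  rewrite ser_mulX0 addr0 parity_count0 /dirac0.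
  by case: eqP => [->|_]; rewrite ?ser0 // cards0 /= coef1.
rewrite ser_mulX -IH; last by lia.
rewrite -natz -[LHS]add0r; congr (_ + _); rewrite /dirac0.
by case: eqP => [->|_]; rewrite ?ser0 // cards0 /= coef1.
Qed.

(** An invariant of peeling which forces the first block to be even. *)
Definition down_closed (S : {set V}) : Prop :=
  forall x, x \in S -> odd (rho x) -> exists2 y, y \in S & R y x.

(** The Eulerian factor of a block [C] has degree sum |C| - 1, and each passage from odd to even
    adds 2. As the first block is even, the total depends only on |S| and the parity of the last
    block, so all summands share one center. *)
Lemma gamma_pos_block_poly_rec (n : nat) (p : bool) (S : {set V}) :
  down_closed S -> gamma_pos #|S| p.+1 (block_poly_rec n p S).
Proof.
elim: n p S => [|n IH] p S cS; first exact: GammaPos0.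
apply: gamma_pos_sum => C CS.
have CsubS := avail_sub CS.
have cSC : down_closed (S :\: C).
  move=> x; rewrite inE => /andP[xC xS] /(cS x xS)[y yS yx]; exists y => //.
  rewrite inE yS andbT; apply/negP => yC.
  by have /availP[_ _ /(_ x xS)] := subsetP CS _ yC; rewrite yx.
have cardS : #|S| = (#|C| + #|S :\: C|)%N.
  by rewrite cardsDS // subnKC // subset_leq_card.
have [->|[x0 x0C]] := set_0Vmem C; first by rewrite cards0 mul0r;
  apply: GammaPos0.
have XwP : gamma_pos #|C| 1 (Xw #|C|).
  have : (0 < #|C|)%N by apply/card_gt0P; exists x0.
  by case: #|C| => // m _; apply: gamma_pos_euler.
rewrite cardS -add1n; apply: gamma_posM => //.
(* An odd first block would contain an even predecessor of one of its elements. *)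
have d0 : S :\: C = set0 -> p = false.
  move=> SC0; apply/negP => pT; have /availP[x0S xp _] := subsetP CS _ x0C.
  have [|y yS /rhoS e] := cS x0 x0S; first by rewrite xp.
  have yC : y \in C.
    by move/setP/(_ y): SC0; rewrite !inE yS andbT => /negbFE.
  have /availP[_ yp _] := subsetP CS _ yC.
  by move: xp; rewrite e /= yp pT.
apply: GammaPosD.
  rewrite /dirac0; case: eqP => [SC0|_]; last exact: GammaPos0.
  by rewrite (d0 SC0) SC0 cards0; apply: gamma_pos1.
case: p {CS d0} => /=.
  by rewrite expr0 mul1r; apply: (IH false).
rewrite expr1; apply: (@gamma_posW (2 + #|S :\: C|) (0 + 2)); first by lia.
by apply: gamma_posM; [apply: gamma_posX|apply: (IH true)].
Qed.

(** * From monotone maps to parity maps *)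

Definition monotone_maps (t : nat) : {set {ffun V -> 'I_t.+1}} :=
  [set z : {ffun V -> 'I_t.+1} | [forall x, [forall y, R x y ==> (z x <= z
    y)%N]]].

Lemma monotone_mapsP (t : nat) (z : {ffun V -> 'I_t.+1}) :
  reflect (forall x y, R x y -> (z x <= z y)%N) (z \in monotone_maps t).
Proof.
rewrite inE; apply: (iffP forallP) => H x.
  by move=> y xy; move: (H x) => /forallP/(_ y)/implyP; apply.
by apply/forallP => y; apply/implyP; apply: H.
Qed.

Section Graded.
Variable c : nat.
Hypothesis rho_le : forall x, (rho x <= c)%N.
Hypothesis rho_down : forall x, (0 < rho x)%N -> exists y, R y x.
Hypothesis rho_up : forall x, (rho x < c)%N -> exists y, R x y.

Lemma parity_map_ge (K M : nat) (s : {ffun V -> 'I_K.+1}) (x : V) :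
  parity_map setT M s -> (rho x <= s x)%N.
Proof.
case/parity_mapP=> _ _ sR.
have [n] := ubnP (rho x); elim: n x => // n IH x.
case: (posnP (rho x)) => [-> //|/rho_down[y yx]]; rewrite (rhoS yx) => xn.
by apply: (leq_ltn_trans (IH y xn)); apply: sR; rewrite ?inE.
Qed.

(** Climb to rank c. There the strict bound and the parity of c give at most 2 t + c, whether c is
    even or odd; each step down the chain lowers the bound by at least one. *)
Lemma parity_map_le (K t : nat) (s : {ffun V -> 'I_K.+1}) (x : V) :
  parity_map setT (t + c./2).*2.+2 s -> (s x <= t.*2 + rho x)%N.
Proof.
case/parity_mapP=> sM _ sR.
have [n] := ubnP (c - rho x); elim: n x => // n IH x xn.
have [xc|cx] := ltnP (rho x) c.
  have [y xy] := rho_up xc; have := rhoS xy => yx.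
  have := sR x y (in_setT _) (in_setT _) xy.
  by have := IH y; rewrite yx; lia.
have xc : rho x = c by apply/eqP; rewrite eqn_leq rho_le.
by have [] := sM x (in_setT _); rewrite xc; lia.
Qed.

(** The bijection is s = 2 z + rho. Along a cover s increases by twice the increase of z plus one,
    so strictness of s is monotonicity of z; the two preceding bounds keep z within 0, ..., t. *)
Lemma card_monotone_maps (t : nat) :
  #|monotone_maps t| = parity_count (t.*2 + c).+1 setT (t + c./2).*2.+2.
Proof.
pose K := (t.*2 + c).+1.
pose f (z : {ffun V -> 'I_t.+1}) : {ffun V -> 'I_K.+1} :=
  [ffun x => inord ((z x).*2 + rho x)].
have fE (z : {ffun V -> 'I_t.+1}) x : f z x = ((z x).*2 + rho x)%N :> nat.
  by rewrite ffunE inordK // /K; have := ltn_ord (z x); have := rho_le x; lia.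
have f_lt (z : {ffun V -> 'I_t.+1}) x : (f z x < (t + c./2).*2.+2)%N.
  by rewrite fE; have := ltn_ord (z x); have := rho_le x; lia.
have f_inj : injective f.
  move=> z z' /ffunP zz; apply/ffunP => x; apply: val_inj => /=.
  by have := congr1 val (zz x); rewrite /= !fE; lia.
rewrite -(card_imset _ f_inj); apply: eq_card => s.
move: (s : {ffun V -> 'I_K.+1}) => {}s; rewrite inE.
apply/imsetP/idP => [[z /monotone_mapsP zR ->]|sP].
  apply/parity_mapP; split=> [x _|x|x y _ _ xy]; rewrite ?inE // !fE.
    by rewrite -fE f_lt fE oddD odd_double.
  by rewrite (rhoS xy) addnS ltnS leq_add2r leq_double zR.
have sz x : exists k : 'I_t.+1, s x == (k.*2 + rho x)%N :> nat.
  have sge := parity_map_ge x sP; have sle := parity_map_le x sP.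
  have kt : ((s x - rho x)./2 < t.+1)%N.
    by move: sge sle; move: (nat_of_ord (s x)) (rho x) => a b; lia.
  exists (Ordinal kt) => /=;
    case/parity_mapP: sP => /(_ x (in_setT _))[_ sx] _ _.
  (* The added 0 is written as the parity of [s x - rho x], so that half and double cancel. *)
  by rewrite -[(_./2).*2]add0n -[0%N]/(false : nat) -(addbb (odd (rho x)))
    -{1}sx
    -oddB // odd_double_half subnK.
pose z := [ffun x => xchoose (sz x)].
have zE x : s x = ((z x).*2 + rho x)%N :> nat.
  by rewrite ffunE; apply/eqP/(xchooseP (sz x)).
exists z; last by apply/ffunP => x; apply: val_inj; rewrite /= fE zE.
apply/monotone_mapsP => x y xy; case/parity_mapP: sP => _ _ sR.
have := sR x y (in_setT _) (in_setT _) xy.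
by rewrite !zE (rhoS xy) addnS ltnS leq_add2r leq_double.
Qed.

(** An element of rank c needs a value at least c, while only values below 2 t + 2 <= c are allowed.
    The numerator is thus divisible by z^(c./2). *)
Lemma parity_count_small (K t : nat) (x : V) : rho x = c -> (t < c./2)%N ->
  parity_count K setT t.*2.+2 = 0%N.
Proof.
move=> xc tc; apply/eqP; rewrite cards_eq0; apply/eqP/setP => s; rewrite !inE.
apply/negP => sP; have := parity_map_ge x sP.
by case/parity_mapP: sP => /(_ x (in_setT _))[]; lia.
Qed.

(** Every element without successor has rank c, which fixes the parity of the last block. *)
Lemma order_polyT (x : V) : order_poly setT = block_poly (odd c) setT.
Proof.
have av0 : avail (~~ odd c) setT = set0.
  apply/setP => y; rewrite [RHS]inE; apply/negP => /availP[_ yp yR].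
  have [|z yz] := rho_up (x := y); last by have := yR z (in_setT _); rewrite yz.
  rewrite ltn_neqAle rho_le andbT; apply: contraTneq (erefl true) => yc.
  by move: yp; rewrite yc; case: (odd c).
have b0 : block_poly (~~ odd c) setT = 0.
  rewrite block_polyE peel_set0 mul0r add0r big1 // => C.
  by rewrite av0 subset0 => /andP[->].
have d0 : dirac0 setT = 0.
  rewrite /dirac0; case: eqP => // /setP/(_ x).
  by rewrite !inE.
rewrite /order_poly d0 add0r.
by case: (odd c) b0 => /= ->; rewrite ?addr0 ?add0r.
Qed.

Lemma graded_poset_ser (x : V) : rho x = c ->
  exists p : {poly int},
    [/\ ((odd c).+1 <= #|V|)%N, gamma_pos #|V| (odd c).+1 p,
      forall t : nat, #|monotone_maps t|%:Z = ser #|V|.+1 p (t + c./2)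
    & forall t : nat, (t < c./2)%N -> ser #|V|.+1 p t = 0].
Proof.
move=> xc; exists (order_poly setT); split.
- case codd : (odd c); last by apply/card_gt0P; exists x.
  have [|y /rhoS yx] := rho_down (x := x); first by rewrite xc; lia.
  rewrite (cardD1 x) (cardD1 y) !inE.
  by case: eqP yx => // ->; lia.
- rewrite (order_polyT x) -cardsT; apply: gamma_pos_block_poly_rec.
  move=> y _ yodd; have [|z zy] := rho_down (x := y); first by lia.
  by exists z.
- by move=> t; rewrite card_monotone_maps parity_count_ser ?cardsT //; lia.
- move=> t tc; rewrite -cardsT -(@parity_count_ser t.*2.+1) //.
  by rewrite (parity_count_small _ xc tc).
Qed.

End Graded.

End GradedPoset.

(** * Unimodality of the h*-vectors *)

(** The vector consists of the coefficients of p / z^g, a window of a symmetric unimodal sequence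
    padded with zeros. *)
Lemma gamma_pos_hstar (n l g : nat) (p : {poly int}) :
  (l <= n)%N -> gamma_pos n l p -> (forall t, (t < g)%N -> ser n.+1 p t = 0) ->
  exists h : seq int, [/\ size h = n.+1, unimodal h
    & forall t, ser n.+1 p (t + g) =
        \sum_(j < n.+1) h`_j * ('C(t + n - j, n))%:Z].
Proof.
move=> ln pn /ser_eq0_coef p0.
have [p_ge0 p_sym p_hi p_rise] := gamma_pos_coef (subnK ln) pn.
set e := (n - l)%N in p_sym p_hi p_rise.
have size_p : (size p <= n.+1)%N.
  by apply/leq_sizeP => j nj; apply: p_hi; rewrite /e; lia.
exists (mkseq (fun j => p`_(j + g)) n.+1); split; first by rewrite size_mkseq.
  have lt_n i : (i <= e)%N -> (i < n.+1)%N by rewrite /e; lia.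
  (* The middle of [p], shifted by g. If g is beyond the middle, the truncated value 0 is right, as
     the window only descends. *)
  exists (e./2 - g)%N; first by rewrite size_mkseq lt_n //; lia.
  rewrite size_mkseq; split=> [i|j gj jn].
    case: i => [//|i] /andP[_ ie]; rewrite -[i.+1.-1]/i !nth_mkseq ?lt_n //;
      try lia.
    by apply: (p_rise (i + g)%N); lia.
  rewrite !nth_mkseq // 1?ltnW // -[(j.+1 + g)%N]/(j + g).+1.
  have [ej|je] := ltnP e (j + g).+1; first by rewrite (p_hi _ ej).
  (* Reflection in the center turns the descent into a rise. *)
  rewrite -(p_sym _ je) -(p_sym (j + g)%N) 1?ltnW //.
  rewrite -[X in _ <= p`_X](_ : (e - (j + g).+1).+1 = _) ?p_rise //; lia.
move=> t; pose q := drop_poly g p.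
have pE : p = q * 'X^g.
  rewrite -[LHS](poly_take_drop g) [take_poly _ _](_ : _ = 0) ?add0r //.
  by apply/polyP => i; rewrite coef_take_poly coef0; case: ifP => // /p0.
have -> : ser n.+1 p (t + g) = ser n.+1 q t.
  rewrite pE mulrC; elim: (g) => [|g' IH]; first by rewrite mul1r addn0.
  by rewrite addnS exprS -mulrA ser_mulX.
rewrite ser_binE; last by rewrite size_drop_poly; lia.
by apply: eq_bigr => j _; rewrite coef_drop_poly nth_mkseq.
Qed.

(** * Binomial identities for two runs *)

Lemma bin_mul_bin (n m k : nat) : (k <= m)%N ->
  ('C(n, m) * 'C(m, k) = 'C(n, k) * 'C(n - k, m - k))%N.
Proof.
move=> km; have [mn|nm] := leqP m n; last first.
  rewrite (bin_small nm); have [kn|nk] := leqP k n;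
    last by rewrite (bin_small nk).
  by rewrite (@bin_small (n - k)) ?muln0 //; lia.
have f0 : (0 < k`! * (m - k)`! * (n - m)`!)%N by rewrite !muln_gt0 !fact_gt0.
have nk : (m - k <= n - k)%N by lia.
have := bin_fact (leq_trans km mn); rewrite -(bin_fact nk) -(bin_fact mn).
rewrite -(bin_fact km) (_ : (n - k - (m - k) = n - m)%N); last by lia.
move=> E; apply/eqP; rewrite -(eqn_pmul2r f0); apply/eqP.
by move: E; rewrite mulnCA mulnA mulnA mulnA; nia.
Qed.

(* Both sides equal [\sum_i C(p, i) C(q + i, i) C(v + q, q + i)]. *)
Lemma bin_mul_expand (p q v : nat) :
  ('C(v + p, p) * 'C(v + q, q) =
   \sum_(i < p.+1) 'C(p, i) * 'C(q, i) * 'C(v + (p + q) - i, p + q))%N.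
Proof.
transitivity (\sum_(i < p.+1) 'C(p, i) * 'C(q + i, i) * 'C(v + q, q + i))%N.
  rewrite -binomial.Vandermonde big_distrl /=; apply: eq_bigr => i _.
  have ip : (i <= p)%N by rewrite -ltnS.
  rewrite bin_sub // -mulnA mulnCA -mulnA; congr (_ * _)%N.
  have := @bin_mul_bin (v + q) (q + i) q (leq_addr _ _).
  have -> : 'C(q + i, q) = 'C(q + i, i) by rewrite -[RHS]bin_sub ?leq_addl
    ?addnK.
  by rewrite addnK addKn => bm; rewrite [LHS]mulnC -bm mulnC.
(* Vandermonde for (p - j) + (v + q), read in reverse order; only p + 1 of its terms can be
   nonzero. *)
have E j : (j < p.+1)%N -> 'C(v + (p + q) - j, p + q) =
    (\sum_(i < p.+1) 'C(p - j, p - i) * 'C(v + q, q + i))%N.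
  rewrite ltnS => jp; rewrite (_ : (_ - j = (p - j) + (v + q))%N); last by lia.
  rewrite -binomial.Vandermonde -addSn big_split_ord /= [X in (_ + X)%N]big1
    ?addn0.
    rewrite (reindex_inj rev_ord_inj); apply: eq_bigr => i _ /=.
    by have := ltn_ord i; rewrite subSS ltnS => ip; congr (_ * 'C(_, _))%N; lia.
  by move=> i _; rewrite bin_small //; lia.
under [RHS]eq_bigr => j _ do rewrite E // big_distrr /=.
rewrite exchange_big /=; apply: eq_bigr => i _; have := ltn_ord i;
  rewrite ltnS => ip.
under eq_bigr => j _ do rewrite mulnA.
rewrite -big_distrl /=; congr (_ * _)%N.
(* Expand C(q + i, i), then use C(p, i) C(i, j) = C(p, j) C(p - j, i - j). *)
rewrite -(binomial.Vandermonde q i i) big_distrr /=.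
rewrite (big_ord_widen_cond p.+1 xpredT (fun j => 'C(p, i) * ('C(q, j) * 'C(i,
  i - j)))%N) //.
rewrite [RHS](bigID (fun j : 'I_p.+1 => (j < i.+1)%N)) /= [X in (_ + X)%N]big1.
  rewrite addn0; apply: eq_big => [//|j]; rewrite /= ltnS => ji.
  rewrite bin_sub // -[RHS]mulnA mulnCA [RHS]mulnCA; congr (_ * _)%N.
  rewrite bin_mul_bin //; congr (_ * _)%N.
  by rewrite -bin_sub; [congr binomial|]; lia.
move=> j; rewrite -leqNgt => ij; have := ltn_ord j => jp.
by rewrite (@bin_small (p - j)) ?muln0 //; lia.
Qed.

Lemma binM_unimodal (p q n : nat) : (p + q <= n)%N ->
  unimodal (mkseq (fun i => ('C(p, i) * 'C(q, i))%:Z) n.+1).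
Proof.
(* The ratio of consecutive entries is (p - i) (q - i) / (i + 1)^2, at least 1 exactly when i (p + q
   + 2) < p q. The peak is the first i where this fails. *)
move=> pqn; pose P i := (p * q <= i * (p + q + 2))%N.
have exP : exists i, P i by exists (p * q)%N; rewrite /P; nia.
have minP m : P m -> (ex_minn exP <= m)%N by case: ex_minnP => k _; apply.
case: ex_minnP minP => k Pk kmin _.
have kn : (k < n.+1)%N.
  by rewrite ltnS (leq_trans _ pqn) // kmin // /P; nia.
have rat i : ((i.+1) ^ 2 * ('C(p, i.+1) * 'C(q, i.+1)) =
    (p - i) * (q - i) * ('C(p, i) * 'C(q, i)))%N.
  by rewrite expnS expn1 mulnACA !mul_bin_left mulnACA.
exists k; rewrite size_mkseq //; split=> [i|j kj jn].
  case: i => [//|i] ik; rewrite -[i.+1.-1]/i !nth_mkseq; try lia.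
  rewrite lez_nat -(@leq_pmul2l (i.+1 ^ 2)) // rat leq_mul2r.
  apply/orP; right; have : ~~ P i by apply/negP => /kmin; lia.
  rewrite /P -ltnNge => iP; have ip : (i < p)%N by nia.
  have iq : (i < q)%N by nia.
  by rewrite expnS expn1; nia.
rewrite !nth_mkseq ?(ltnW jn) // lez_nat.
rewrite -(@leq_pmul2l (j.+1 ^ 2)) // rat leq_mul2r; apply/orP; right.
have Pj : P j by rewrite /P (leq_trans Pk) // leq_mul2r kj orbT.
rewrite expnS expn1; have [jp|jp] := leqP p j; first by rewrite (eqP jp).
have [jq|jq] := leqP q j; first by rewrite (eqP jq) muln0.
by move: Pj; rewrite /P; nia.
Qed.

(** * Monotone maps on fences *)

(** A step (1,0) of the snake puts vertex k below vertex k + 1, a step (0,1) puts it above. *)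
Definition fence (w : seq bool) : rel 'I_(size w).+1 := fun x y =>
  (y == x.+1 :> nat) && ~~ nth false w x || (x == y.+1 :> nat) && nth false w y.
Arguments fence : clear implicits.

Lemma fence_monotoneP (w : seq bool) (t : nat) (z : {ffun 'I_(size w).+1 ->
  'I_t.+1}) :
  reflect (forall k, (k < size w)%N ->
             if nth false w k then (z (inord k.+1) <= z (inord k))%N
             else (z (inord k) <= z (inord k.+1))%N)
          (z \in monotone_maps (fence w) t).
Proof.
apply: (iffP (monotone_mapsP _ _)) => H.
  move=> k kw; case wk: (nth _ _ _); apply: H.
    by apply/orP; right; rewrite !inordK ?ltnS ?(ltnW kw) // wk eqxx.
  by apply/orP; left; rewrite !inordK ?ltnS ?(ltnW kw) // wk eqxx.
move=> x y; case/orP=> /andP[/eqP e w_].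
  have := H x; rewrite (negbTE w_) -e !inord_val; apply.
  by have := ltn_ord y; rewrite e.
have := H y; rewrite w_ -e !inord_val; apply.
by have := ltn_ord x; rewrite e.
Qed.

Lemma sum_bin_shift (n j : nat) :
  (\sum_(v < n) 'C(v + j, j) = 'C(n + j, j.+1))%N.
Proof.
elim: n => [|n IH]; first by rewrite big_ord0 bin_small.
by rewrite big_ord_recr /= IH addSn binS.
Qed.

Lemma sum_bin_le (t j : nat) (u : 'I_t.+1) :
  (\sum_(v < t.+1 | v <= u) 'C(v + j, j) = 'C(u + j.+1, j.+1))%N.
Proof.
by rewrite addnS -addSn -sum_bin_shift (big_ord_widen t.+1 (fun v => 'C(v + j,
  j))).
Qed.

Definition count_from (w : seq bool) (t : nat) (v : 'I_t.+1) : nat :=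
  #|[set z in monotone_maps (fence w) t | z ord0 == v]|.

Lemma count_from_nil (t : nat) (v : 'I_t.+1) : count_from [::] v = 1%N.
Proof.
apply/eqP/cards1P; exists [ffun=> v]; apply/setP => z;
  rewrite finset.in_set finset.in_set1.
apply/andP/eqP => [[_ /eqP zv]|->].
  by apply/ffunP => i; rewrite ffunE -zv (ord1 i).
by split; [apply/fence_monotoneP|rewrite ffunE].
Qed.

Definition ffun_cons (n t : nat) (v : 'I_t.+1) (z : {ffun 'I_n -> 'I_t.+1}) :
    {ffun 'I_n.+1 -> 'I_t.+1} :=
  [ffun i => if unlift ord0 i is Some j then z j else v].

Lemma ffun_cons_inord (n t k : nat) (v : 'I_t.+1) (z : {ffun 'I_n.+1 ->
  'I_t.+1}) :
  (k <= n)%N -> ffun_cons v z (inord k.+1) = z (inord k).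
Proof.
move=> kn; rewrite ffunE (_ : inord k.+1 = lift ord0 (inord k)) ?liftK //.
by apply: val_inj; rewrite /= inordK ?inordK ?ltnS.
Qed.

Lemma ffun_cons0 (n t : nat) (v : 'I_t.+1) (z : {ffun 'I_n -> 'I_t.+1}) :
  ffun_cons v z ord0 = v.
Proof. by rewrite ffunE unlift_none. Qed.

Lemma monotone_fence_cons (d : bool) (w : seq bool) (t : nat) (v : 'I_t.+1)
    (z : {ffun 'I_(size w).+1 -> 'I_t.+1}) :
  (ffun_cons v z \in monotone_maps (fence (d :: w)) t) =
  (if d then z ord0 <= v else v <= z ord0)%N && (z \in monotone_maps (fence w)
    t).
Proof.
have inord0 n : inord 0 = ord0 :> 'I_n.+1 by apply: val_inj; rewrite /= inordK.
apply/fence_monotoneP/andP => [H|[H0 /fence_monotoneP H]].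
  split.
    by have := H 0%N isT; rewrite ffun_cons_inord // !inord0 ffun_cons0.
  apply/fence_monotoneP => k kw; have := H k.+1 kw.
  by rewrite !ffun_cons_inord // ltnW.
case=> [_|k kw]; last first.
  have {}kw : (k < size w)%N by [].
  by rewrite !ffun_cons_inord ?(ltnW kw) //; exact: (H k kw).
by rewrite ffun_cons_inord // !inord0 ffun_cons0.
Qed.

Lemma count_from_cons (d : bool) (w : seq bool) (t : nat) (v : 'I_t.+1) :
  count_from (d :: w) v =
  (\sum_(u < t.+1 | if d then u <= v else v <= u) count_from w u)%N.
Proof.
rewrite /count_from -sum1_card.
pose tail (z : {ffun 'I_(size w).+2 -> 'I_t.+1}) :
    {ffun 'I_(size w).+1 -> 'I_t.+1} := [ffun j : 'I_(size w).+1 => z (lift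
      ord0 j)].
have tailK (z : {ffun 'I_(size w).+2 -> 'I_t.+1}) : z ord0 = v -> ffun_cons v
  (tail z) = z.
  move=> z0; apply/ffunP => i; rewrite ffunE.
  by case: unliftP => [j ->|->]; rewrite ?ffunE.
have consK z : tail (ffun_cons v z) = z.
  by apply/ffunP => j; rewrite !ffunE liftK.
rewrite (reindex_onto (@ffun_cons (size w).+1 t v) tail) /=; last first.
  by move=> z; rewrite inE => /andP[_ /eqP/tailK].
rewrite (eq_bigl (fun z : {ffun 'I_(size w).+1 -> 'I_t.+1} =>
  (if d then z ord0 <= v else v <= z ord0)%N && (z \in monotone_maps (fence w)
    t)));
  last first.
  move=> z; rewrite consK eqxx andbT -monotone_fence_cons.
  by rewrite [LHS]inE ffun_cons0 eqxx andbT.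
rewrite (partition_big (fun z : {ffun 'I_(size w).+1 -> 'I_t.+1} => z ord0)
  (fun u => if d then u <= v else v <= u)%N) /=; last by move=> z /andP[].
apply: eq_bigr => u uv; rewrite -sum1_card; apply: eq_bigl => z.
rewrite [RHS]inE; case: eqP => [->|]; rewrite ?andbF //.
by rewrite uv !andbT.
Qed.

Lemma count_from_down (q t : nat) (v : 'I_t.+1) :
  count_from (nseq q true) v = 'C(v + q, q).
Proof.
elim: q v => [|q IH] v; first by rewrite count_from_nil bin0.
rewrite count_from_cons -sum_bin_le; apply: eq_bigr => u _; exact: IH.
Qed.

(** The weight C(v + j, j) counts ascending chains of j points bounded by v; each ascending step
    lengthens the chain by one, by the hockey-stick identity. *)
Lemma count_from_up (w : seq bool) (t i j : nat) :
  (\sum_(v < t.+1) 'C(v + j, j) * count_from (nseq i false ++ w) v =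
   \sum_(u < t.+1) 'C(u + (j + i), j + i) * count_from w u)%N.
Proof.
elim: i j => [|i IH] j; first by rewrite addn0.
under eq_bigr => v _ do rewrite count_from_cons big_distrr /=.
rewrite (exchange_big_dep xpredT) //= -addSnnS -IH; apply: eq_bigr => u _.
by rewrite -big_distrl /= sum_bin_le.
Qed.

Lemma card_monotone_two_runs (p q t : nat) :
  #|monotone_maps (fence (nseq p false ++ nseq q true)) t| =
  (\sum_(v < t.+1) 'C(v + p, p) * 'C(v + q, q))%N.
Proof.
rewrite -[RHS](eq_bigr _ (fun (v : 'I_t.+1) _ => congr1 (muln _)
  (count_from_down q v))).
have := count_from_up (nseq q true) t p 0; rewrite add0n => <-.
set w := _ ++ _; rewrite -sum1_card.
rewrite (partition_big (fun z : {ffun 'I_(size w).+1 -> 'I_t.+1} => z ord0)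
  xpredT) //=.
apply: eq_bigr => v _; rewrite bin0 mul1n /count_from -sum1_card.
by apply: eq_bigl => z; rewrite [RHS]inE.
Qed.

Lemma sum_bin_sub (t n i : nat) : (i <= n)%N ->
  (\sum_(v < t.+1) 'C(v + n - i, n) = 'C(t + n.+1 - i, n.+1))%N.
Proof.
move=> i_n; elim: t => [|t IH].
  rewrite big_ord1 !add0n; case: i i_n => [|i] i_n;
    first by rewrite !subn0 !binn.
  by rewrite !bin_small //; lia.
rewrite big_ord_recr /= IH (_ : (t.+1 + n - i = t + n.+1 - i)%N); last by lia.
by rewrite (_ : (t.+1 + n.+1 - i = (t + n.+1 - i).+1)%N) ?binS //; lia.
Qed.

(** * Lattice points of lattice path matroid polytopes *)

Local Open Scope classical_set_scope.

Lemma heightS (p : seq bool) (k : nat) : (k < size p)%N ->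
  height p k.+1 = (height p k + nth false p k)%N.
Proof.
move=> kp; rewrite /height (take_nth false) // -cats1 count_cat /= addn0.
by case: (nth _ _ _).
Qed.

Lemma path_to_size (m r : nat) (p : seq bool) : path_to m r p -> size p = (r +
  m)%N.
Proof.
case/andP=> /eqP <- /eqP <-; rewrite -(count_predC (pred1 true)).
by congr (_ + _)%N; apply: eq_count => -[].
Qed.

Lemma path_to_height (m r : nat) (p : seq bool) :
  path_to m r p -> height p (r + m) = r.
Proof.
move=> pP; rewrite -(path_to_size pP) /height take_size.
by case/andP: pP => _ /eqP.
Qed.

(** Hermite's identity on integers, used to split a profile into t lattice paths. *)
Lemma sum_divn (t y : nat) : (0 < t)%N -> (\sum_(j < t) (y + j) %/ t = y)%N.
Proof.
case: t => // t _; elim: y => [|y IH].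
  by rewrite big1 // => j _; rewrite add0n divn_small.
under eq_bigr do rewrite addSnnS.
rewrite big_ord_recr /= divnDr // divnn /= addn1 addnS addnC; congr _.+1.
by rewrite -[RHS]IH big_ord_recl addn0; congr addn; apply: eq_bigr.
Qed.

Definition psum (R : realType) (n : nat) (x : 'rV[R]_n) (k : nat) : R :=
  \sum_(i < n | (i < k)%N) x 0 i.

Lemma psum0 (R : realType) (n : nat) (x : 'rV[R]_n) : psum x 0 = 0.
Proof. exact: big_pred0. Qed.

Lemma psumS (R : realType) (n : nat) (x : 'rV[R]_n) (i : 'I_n) :
  psum x i.+1 = psum x i + x 0 i.
Proof.
rewrite /psum (bigD1 i) //= addrC; congr (_ + _); apply: eq_bigl => j.
by rewrite ltnS leq_eqVlt andb_orl -(inj_eq val_inj) /=; case: ltngtP.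
Qed.

Lemma psum_lin (R : realType) (n k : nat) (I : finType) (c : I -> R)
    (v : I -> 'rV[R]_n) :
  psum (\sum_j c j *: v j) k = \sum_j c j * psum (v j) k.
Proof.
rewrite /psum; under eq_bigr do rewrite summxE.
rewrite exchange_big /=; apply: eq_bigr => j _; rewrite mulr_sumr.
by apply: eq_bigr => i _; rewrite mxE.
Qed.

Lemma indicatorE (R : realType) (n : nat) (B : {set 'I_n}) (i : 'I_n) :
  (\sum_(l in B) delta_mx 0 l : 'rV[R]_n) 0 i = (i \in B)%:R.
Proof.
rewrite summxE; under eq_bigr do rewrite mxE eqxx /=.
have [iB|iB] := boolP (i \in B).
  by rewrite (bigD1 i) //= eqxx big1 ?addr0 // => l /andP[_ /negbTE];
    rewrite eq_sym => ->.
by rewrite big1 // => l lB; case: eqP => // il; rewrite il lB in iB.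
Qed.

Lemma psum_north_steps (R : realType) (n k : nat) (p : n.-tuple bool) :
  (k <= n)%N ->
  psum (\sum_(l in north_steps p) delta_mx 0 l : 'rV[R]_n) k = (height p k)%:R.
Proof.
elim: k => [|k IH] kn; first by rewrite psum0 /height take0.
rewrite (psumS _ (Ordinal kn)) /= IH 1?ltnW // heightS ?size_tuple // natrD.
by rewrite indicatorE inE (tnth_nth false).
Qed.

Section LatticePathMatroid.
Variables (m r : nat) (U L : seq bool).
Hypothesis U_path : path_to m r U.
Hypothesis L_path : path_to m r L.

(* The partial sums of the lattice points of the t-th dilate. *)
Definition profile (t : nat) (Y : nat -> nat) : Prop :=
  [/\ Y 0%N = 0%N,
      forall k, (k < r + m)%N -> (Y k <= Y k.+1 <= Y k + t)%N
    & forall k, (k <= r + m)%N -> (t * height L k <= Y k <= t * height U k)%N].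

Lemma profile_basis (t j : nat) (Y : nat -> nat) : (j < t)%N -> profile t Y ->
  exists2 B, B \in lpm_bases m r U L &
    forall i : 'I_(r + m),
      ((Y i + j) %/ t + (i \in B) = (Y i.+1 + j) %/ t)%N.
Proof.
move=> jt [Y0 Ystep Ybnd].
pose y k := ((Y k + j) %/ t)%N.
pose p := [tuple (y i < y i.+1)%N | i < r + m].
have t0 : (0 < t)%N by apply: leq_ltn_trans jt.
have pi k (kn : (k < r + m)%N) : nth false p k = (y k < y k.+1)%N.
  by rewrite -(tnth_nth false p (Ordinal kn)) tnth_mktuple.
have ystep k : (k < r + m)%N -> (y k + (y k < y k.+1)%N = y k.+1)%N.
  move=> kn; have /andP[Y1 Y2] := Ystep k kn.
  have y1 : (y k <= y k.+1)%N by rewrite leq_div2r // leq_add2r.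
  have y2 : (y k.+1 <= (y k).+1)%N.
    have -> : (y k).+1 = ((Y k + j) %/ t + t %/ t)%N by rewrite divnn t0 addn1.
    by rewrite -divnDr // leq_div2r //; lia.
  by move: (y k) (y k.+1) y1 y2 => a b; lia.
have hp k : (k <= r + m)%N -> height p k = y k.
  elim: k => [|k IH] kn; first by rewrite /height take0 /y Y0 divn_small.
  by rewrite heightS ?size_tuple // IH 1?ltnW // pi // ystep.
have hLU k : (k <= r + m)%N -> (height L k <= height p k <= height U k)%N.
  move=> kn; rewrite hp //; have /andP[l u] := Ybnd k kn; apply/andP; split.
    by rewrite leq_divRL // mulnC (leq_trans l) // leq_addr.
  by rewrite -ltnS ltn_divLR // mulSn mulnC; lia.
exists (north_steps p).
  apply/imsetP; exists p => //; rewrite inE; apply/and3P; split.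
  - have := hLU _ (leqnn _);
    rewrite (path_to_height U_path) (path_to_height L_path) -eqn_leq => /eqP hr.
    have : height p (r + m) = count_mem true p.
      by rewrite /height take_oversize // size_tuple.
    rewrite -hr => /esym cr.
    have := count_predC (pred1 true) p; rewrite size_tuple cr => /addnI cm.
    rewrite /path_to cr eqxx andbT -[X in _ == X]cm.
    by apply/eqP/eq_count => -[].
  - by apply/forallP => k; have /andP[] := hLU k (leq_ord k).
  - by apply/forallP => k; have /andP[] := hLU k (leq_ord k).
by move=> i; rewrite inE tnth_mktuple; apply: ystep.
Qed.

Variable R : realType.
Let P : set 'rV[R]_(r + m) := basis_polytope R (lpm_bases m r U L).

Lemma psum_lpm (x : 'rV[R]_(r + m)) (k : nat) : P x -> (k <= r + m)%N ->
  (height L k)%:R <= psum x k <= (height U k)%:R.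
Proof.
case=> l [c [v [c0 c1 vB ->]]] kn; rewrite psum_lin.
have vk j : (height L k)%:R <= psum (v j) k <= (height U k)%:R.
  have [_ /imsetP[p /[!inE] /and3P[_ /forallP pU /forallP Lp] ->] ->] := vB j.
  rewrite psum_north_steps // !ler_nat.
  by rewrite (pU (Ordinal (kn : (k < (r + m).+1)%N))) andbT
             (Lp (Ordinal (kn : (k < (r + m).+1)%N))).
have cst (a : R) : a = \sum_j c j * a by rewrite -mulr_suml c1 mul1r.
apply/andP; split; [rewrite [leLHS]cst|rewrite [leRHS]cst].
all: by apply: ler_sum => j _; apply: ler_wpM2l => //; case/andP: (vk j).
Qed.

Lemma psum_lpm_total (x : 'rV[R]_(r + m)) : P x -> psum x (r + m) = r%:R.
Proof.
move=> Px; have := psum_lpm Px (leqnn _);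
  rewrite (path_to_height U_path) (path_to_height L_path).
by rewrite -eq_le => /eqP.
Qed.

Lemma lattice_point_profile (t : nat) (z : 'rV[int]_(r + m)) :
  dilate_lattice_points P t z ->
  exists2 Y, profile t Y & forall i, z 0 i = (Y i.+1)%:Z - (Y i)%:Z.
Proof.
case=> x Px zx; have x01 := basis_polytope_unit_cube Px.
have psum_ge0 k : 0 <= psum x k.
  by apply: sumr_ge0 => i _; case/andP: (x01 i).
have zE i : (z 0 i)%:~R = t%:R * x 0 i.
  by have := congr1 (fun u : 'rV[R]_(r + m) => u 0 i) zx; rewrite !mxE.
pose S k := \sum_(i < r + m | (i < k)%N) z 0 i.
have SE k : (S k)%:~R = t%:R * psum x k.
  by rewrite /S rmorph_sum mulr_sumr; apply: eq_bigr => i _; apply: zE.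
have S0 k : 0 <= S k by rewrite -(ler_int R) SE mulr_ge0.
(* The partial sums are nonnegative, so the absolute value only changes the type. *)
pose Y k := absz (S k).
have YE k : (Y k)%:R = t%:R * psum x k :> R.
  by rewrite -SE -[in RHS](gez0_abs (S0 k)).
have Ystep (i : 'I_(r + m)) : (Y i.+1)%:R = (Y i)%:R + t%:R * x 0 i :> R.
  by rewrite !YE psumS mulrDr.
exists Y; last first.
  move=> i; apply: (@mulrIz R 1 (oner_neq0 R)).
  by rewrite zE rmorphB /= -!pmulrn Ystep addrAC subrr add0r.
split.
- by apply/eqP; rewrite -(eqr_nat R) YE psum0 mulr0.
- move=> k kn; have := Ystep (Ordinal kn);
  have /andP[x0 x1] := x01 (Ordinal kn).
  rewrite -(ler_nat R) -(ler_nat R (Y k.+1)) natrD /= => ->.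
  by rewrite lerDl lerD2l mulr_ge0 //= ler_piMr.
- move=> k kn; have /andP[l u] := psum_lpm Px kn.
  by rewrite -(ler_nat R) -(ler_nat R (Y k)) !natrM YE !ler_wpM2l.
Qed.

(** Round with each offset j < t. By [sum_divn] the indicators of the t bases add up to [z], which
    is therefore t times their average. For t = 0 any basis is a witness. *)
Lemma profile_lattice_point (t : nat) (Y : nat -> nat) (z : 'rV[int]_(r + m)) :
  lpm_bases m r U L != finset.set0 -> profile t Y ->
  (forall i, z 0 i = (Y i.+1)%:Z - (Y i)%:Z) -> dilate_lattice_points P t z.
Proof.
move=> B0 YP zY; have [t0|t0] := posnP t.
  have [B BB] := finset.set0Pn _ B0.
  exists (\sum_(i in B) delta_mx 0 i).
    exists 1%N, (fun=> 1), (fun=> \sum_(i in B) delta_mx 0 i); split=> //.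
    - by rewrite big_ord1.
    - by move=> _; exists B.
    - by rewrite big_ord1 scale1r.
  rewrite t0 scale0r; apply/rowP => i; rewrite !mxE zY.
  have Yk k : (k <= r + m)%N -> Y k = 0%N.
    by case: YP => _ _ /[apply]; rewrite t0 !mul0n; lia.
  by rewrite !Yk // ltnW.
have ex_B (j : 'I_t) : exists B, (B \in lpm_bases m r U L) &&
    [forall i : 'I_(r + m), (Y i + j) %/ t + (i \in B) == (Y i.+1 + j) %/ t]%N.
  have [B BB BE] := profile_basis (ltn_ord j) YP.
  by exists B; rewrite BB; apply/forallP => i; rewrite BE.
pose B j := xchoose (ex_B j).
have tR : t%:R != 0 :> R by rewrite pnatr_eq0 -lt0n.
exists (\sum_(j < t) t%:R^-1 *: \sum_(i in B j) delta_mx 0 i).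
  exists t, (fun=> t%:R^-1), (fun j => \sum_(i in B j) delta_mx 0 i);
    split=> //.
  - by move=> j; rewrite invr_ge0.
  - by rewrite sumr_const card_ord -(mulr_natl t%:R^-1) divff.
  - by move=> j; exists (B j) => //; have /andP[] := xchooseP (ex_B j).
rewrite -scaler_sumr scalerA divff // scale1r; apply/rowP => i.
rewrite mxE zY summxE; under eq_bigr do rewrite indicatorE.
rewrite -natr_sum rmorphB /= -!pmulrn; apply/eqP;
  rewrite subr_eq -natrD eqr_nat.
rewrite -[Y i.+1](sum_divn _ t0) -[X in _ == (_ + X)%N](sum_divn _ t0).
rewrite -big_split; apply/eqP/eq_bigr => j _ /=.
have /andP[_ /forallP/(_ i)/eqP <-] := xchooseP (ex_B j).
exact: addnC.
Qed.

End LatticePathMatroid.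

(** * Snakes *)

Section Snake.
Variable a : seq nat.
Let w := snake_moves false a.
Let r := snake_height a.
Let m := snake_width a.
Let U := snake_upper a.
Let L := snake_lower a.

Lemma count_rcons (p : pred bool) (s : seq bool) (b : bool) :
  count p (rcons s b) = (count p s + p b)%N.
Proof. by rewrite -cats1 count_cat /= addn0. Qed.

Lemma snake_heightE : r = (count_mem true w).+1.
Proof. by rewrite /r /snake_height /= count_rcons addn0. Qed.

Lemma snake_sizeE : (r + m)%N = (size w).+2.
Proof.
rewrite snake_heightE /m /snake_width /= count_rcons add0n addn1 addnS addSn.
rewrite -(count_predC (pred1 true) w); congr (_ + _).+2.
by apply: eq_count => -[].
Qed.

Lemma snake_upper_path : path_to m r U.
Proof. by rewrite /path_to !eqxx. Qed.

Lemma snake_lower_path : path_to m r L.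
Proof.
apply/andP; split; apply/eqP; rewrite /m /r /snake_width /snake_height /=.
  by rewrite !count_rcons !addn0 addn1.
by rewrite !count_rcons addn0 addn1.
Qed.

Lemma snake_upper_height (k : nat) : (k <= size w)%N ->
  height U k.+1 = (height w k).+1.
Proof. by move=> kw; rewrite height_cons height_rcons. Qed.

Lemma snake_lower_height (k : nat) : (k <= size w)%N ->
  height L k.+1 = height w k.
Proof. by move=> kw; rewrite height_cons height_rcons. Qed.

(** [z] is the excess over t times the lower path, whose height at k' + 1 is [height w k']. At both
    ends the paths meet and the value is forced. *)
Definition fence_profile (t : nat) (z : {ffun 'I_(size w).+1 -> 'I_t.+1})
    (k : nat) : nat :=
  if k is k'.+1 then
    if (k' <= size w)%N then (t * height w k' + z (inord k'))%N else (t * r)%N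
  else 0%N.

(** On a step (1,0) of [w], that Y does not decrease says that z does not; on a step (0,1), that Y
    grows by at most t says that z does not increase. The other inequality follows from 0 <= z <=
    t. *)
Lemma fence_profileP (t : nat) (z : {ffun 'I_(size w).+1 -> 'I_t.+1}) :
  z \in monotone_maps (fence w) t -> profile m r U L t (fence_profile z).
Proof.
have zt k : (z k <= t)%N by rewrite -ltnS.
move=> /fence_monotoneP zP; split=> // [k|k].
  rewrite snake_sizeE ltnS; case: k => [_|k].
    by rewrite /= /height take0 muln0 add0n zt.
  rewrite ltnS /fence_profile => kw; rewrite kw.
  case: ltnP => [{}kw|wk].
    rewrite heightS //.
    move: (zP k kw) (zt (inord k)) (zt (inord k.+1)).
    move: (nat_of_ord (z (inord k))) (nat_of_ord (z (inord k.+1))) => u v.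
    by case: (nth _ _ _) => /=; rewrite mulnDr ?muln1 ?muln0; lia.
  have -> : r = (height w k).+1 by rewrite snake_heightE /height take_oversize.
  by rewrite mulnS; have := zt (inord k); lia.
case: k => [|k]; first by rewrite /height !take0 !muln0.
rewrite leq_eqVlt => /orP[/eqP kn|].
  have -> : fence_profile z k.+1 = (t * r)%N.
    by move: kn; rewrite snake_sizeE => -[->]; rewrite /= ltnn.
  rewrite kn (path_to_height snake_upper_path) (path_to_height
    snake_lower_path).
  by rewrite leqnn.
rewrite snake_sizeE !ltnS => kw.
rewrite snake_upper_height // snake_lower_height // /fence_profile kw.
by rewrite leq_addr mulnS addnC leq_add2r zt.
Qed.

Lemma profile_fence (t : nat) (Y : nat -> nat) : profile m r U L t Y ->
  exists2 z : {ffun 'I_(size w).+1 -> 'I_t.+1}, z \in monotone_maps (fence w) t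
    &
    forall k, (k <= r + m)%N -> Y k = fence_profile z k.
Proof.
case=> Y0 Ystep Ybnd.
have bnd k : (k <= size w)%N ->
    (t * height w k <= Y k.+1 <= t * height w k + t)%N.
  move=> kw; have := Ybnd k.+1;
    rewrite snake_sizeE !ltnS ltnW ?ltnS // => /(_ erefl).
  by rewrite snake_upper_height // snake_lower_height // mulnS [(t + _)%N]addnC.
pose z := [ffun i : 'I_(size w).+1 => inord (Y i.+1 - t * height w i) :
  'I_t.+1].
have zE k : (k <= size w)%N -> z (inord k) = (Y k.+1 - t * height w k)%N :> nat.
  move=> kw; rewrite ffunE inordK inordK ?ltnS //.
  by have := bnd k kw; lia.
exists z.
  apply/fence_monotoneP => k kw; rewrite !zE ?(ltnW kw) // heightS //.
  have := bnd k (ltnW kw); have := bnd _ kw; rewrite heightS //.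
  have := Ystep k.+1; rewrite snake_sizeE !ltnS => /(_ (ltnW kw)).
  by case: (nth _ _ _) => /=; nia.
move=> [|k]; first by rewrite Y0.
rewrite leq_eqVlt => /orP[/eqP kn|].
  have -> : fence_profile z k.+1 = (t * r)%N.
    by move: kn; rewrite snake_sizeE => -[->]; rewrite /= ltnn.
  have := Ybnd k.+1; rewrite kn leqnn => /(_ erefl).
  rewrite (path_to_height snake_upper_path) (path_to_height snake_lower_path).
  by rewrite -eqn_leq => /eqP.
rewrite snake_sizeE !ltnS => kw; rewrite /fence_profile kw zE // subnKC //.
by case/andP: (bnd k kw).
Qed.

(** The zero map at t = 1 is the profile of the lower path. *)
Lemma snake_bases_neq0 : snake_bases a != finset.set0.
Proof.
have := @fence_profileP 1 [ffun=> ord0].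
case=> [|Y0 Ys Yb].
  by apply/fence_monotoneP => k _; rewrite !ffunE; case: ifP.
have [B BB _] := @profile_basis m r U L snake_upper_path snake_lower_path
  1 0 _ (ltn0Sn 0) (And3 Y0 Ys Yb).
by apply/finset.set0Pn; exists B.
Qed.

Variable R : realType.
Let P := snake_polytope R a.

Definition fence_row (t : nat) (z : {ffun 'I_(size w).+1 -> 'I_t.+1}) :
    'rV[int]_(r + m) :=
  \row_i ((fence_profile z i.+1)%:Z - (fence_profile z i)%:Z).

Lemma fence_row_inj (t : nat) : injective (@fence_row t).
Proof.
move=> z z' /rowP zz.
have E k : (k <= r + m)%N -> fence_profile z k = fence_profile z' k.
  elim: k => // k IH kn; have := zz (Ordinal kn); rewrite !mxE.
  by rewrite -[nat_of_ord (Ordinal kn)]/k IH 1?ltnW // => /addIr [].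
apply/ffunP => i; apply: val_inj => /=.
have iw : (i <= size w)%N by rewrite -ltnS.
have := E i.+1; rewrite snake_sizeE ltnS ltnW ?ltnS // => /(_ erefl).
by rewrite /fence_profile iw inord_val => /addnI.
Qed.

Lemma snake_lattice_points (t : nat) :
  dilate_lattice_points P t = @fence_row t @` [set` monotone_maps (fence w) t].
Proof.
apply/seteqP; split=> z /=.
  case/lattice_point_profile => Y YP zY.
  have [s sP sY] := profile_fence YP; exists s => //.
  by apply/rowP => i; rewrite mxE zY !sY // ltnW.
case=> s sP <-; apply: (profile_lattice_point snake_upper_path
  snake_lower_path).
- exact: snake_bases_neq0.
- exact: fence_profileP sP.
- by move=> i; rewrite mxE.
Qed.

Lemma snake_ehrhart (t : nat) : ehrhart P t = #|monotone_maps (fence w) t|.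
Proof.
rewrite /ehrhart snake_lattice_points.
have -> : [set @fence_row t z | z in [set` monotone_maps (fence w) t]] =
    [set` [fset @fence_row t z | z in monotone_maps (fence w) t]%fset].
  apply/seteqP; split=> z /=.
    by case=> s sP <-; apply/imfsetP; exists s.
  by case/imfsetP => s sP ->; exists s.
by rewrite set_fsetK card_imfset /= -?cardE //; apply: fence_row_inj.
Qed.

(** The constant coordinate sum bounds the dimension from above. From below, one interior map of the
    fence and its unit perturbations at each vertex give independent differences. *)
Lemma snake_dim : polytope_dim P = (size w).+1.
Proof.
apply/eqP; rewrite eqn_leq; apply/andP; split.
  apply/bigmax_leqP => k /asboolP[v [vP]].
  rewrite /affinely_independent; set M := (X in row_free X) => Mfree.
  have M1 : M *m const_mx 1 = 0 :> 'cV_k.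
    apply/colP => i; rewrite !mxE; under eq_bigr do rewrite !mxE mulr1.
    rewrite sumrB; apply/eqP; rewrite subr_eq0; apply/eqP.
    have tot x : P x -> \sum_j x 0 j = r%:R.
      move=> /(psum_lpm_total snake_upper_path snake_lower_path) <-.
      by apply: eq_bigl => j; rewrite ltn_ord.
    by rewrite !tot.
  have := mulmx0_rank_max M1; rewrite (eqP Mfree) => rank_le.
  rewrite -ltnS -snake_sizeE (leq_trans _ rank_le) // -addn1 leq_add2l.
  rewrite lt0n mxrank_eq0; apply/eqP => /colP E.
  have n0 : (0 < r + m)%N by rewrite snake_sizeE.
  by have /eqP := E (Ordinal n0); rewrite !mxE oner_eq0.
have kn : ((size w).+1 < (r + m).+1)%N by rewrite snake_sizeE.
apply: (@leq_bigmax_cond _ _ (fun k : 'I_(r + m).+1 => k : nat) (Ordinal kn)).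
apply/asboolP.
pose N := (size w).+1.
(* Large enough for the values N + k - 2 [height w k], which lie between 1 and 2 N - 1, to be
   increased by one. *)
pose t := N.*2.
have tR : t%:R != 0 :> R by rewrite pnatr_eq0.
(* [c] is strictly monotone on the fence, so that it remains monotone when one
   of its values is increased by one. *)
pose c k := (N + k - (height w k).*2)%N.
have hk k : (height w k <= k)%N.
  by rewrite /height (leq_trans (count_size _ _)) // size_take_min geq_minl.
pose z (j : nat) : {ffun 'I_(size w).+1 -> 'I_t.+1} :=
  [ffun k : 'I_(size w).+1 => inord (c k + (j == k.+1))].
have zE j k : (k <= size w)%N -> z j (inord k) = (c k + (j == k.+1))%N :> nat.
  move=> kw; rewrite ffunE inordK ?inordK // ltnS /c /t /N.
  by case: (_ == _) => /=; lia.
have zP j : z j \in monotone_maps (fence w) t.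
  apply/fence_monotoneP => k kw; rewrite !zE ?(ltnW kw) // /c heightS //.
  have := hk k; have := hk k.+1; rewrite heightS //.
  by case: (nth _ _ _) => /=; rewrite /N; lia.
pose x j : 'rV[R]_(r + m) := t%:R^-1 *: map_mx intr (fence_row (z j)).
have xP j : P (x j).
  have : dilate_lattice_points P t (fence_row (z j)).
    by rewrite snake_lattice_points; exists (z j) => //; apply: zP.
  by case=> y Py yE; rewrite /x yE scalerA mulVf // scale1r.
have profE (i k : nat) : (i <= size w)%N -> (k <= r + m)%N ->
    fence_profile (z i.+1) k = (fence_profile (z 0) k + (i.+1 == k))%N.
  case: k => [|k] // iw _; rewrite /fence_profile.
  case: leqP => kw; first by rewrite !zE // addn0 addnA.
  by rewrite [_ == _](_ : _ = false) ?addn0 //; apply/eqP; lia.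
exists (fun j => x j); split=> //.
apply/row_freeP.
(* The differences are (e_i - e_(i+1)) / t; taking partial sums and multiplying by t inverts
   them. *)
exists (\matrix_(l < r + m, i < (size w).+1) (t%:R * (l <= i)%N%:R)).
apply/matrixP => i i'; rewrite !mxE.
have iw : (i <= size w)%N by rewrite -ltnS.
have entry (l : 'I_(r + m)) : (x (lift ord0 i) - x (@ord0 (size w).+1)) 0 l =
    t%:R^-1 * ((l == i :> nat)%:R - (l == i.+1 :> nat)%:R).
  rewrite !mxE -mulrBr; congr (_ * _); rewrite lift0 !profE //;
    last exact: ltnW.
  rewrite !eqSS [i.+1 == l]eq_sym [(i : nat) == l]eq_sym.
  rewrite !rmorphB /= -!pmulrn !natrD; ring.
have pick (q : nat) (f : nat -> R) : (q < r + m)%N ->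
    \sum_(l < r + m) (l == q :> nat)%:R * f l = f q.
  move=> qn; rewrite (bigD1 (Ordinal qn)) //= eqxx mul1r big1 ?addr0 // => l.
  by rewrite -(inj_eq val_inj) /= => /negbTE ->; rewrite mul0r.
pose f l : R := (l <= i')%N%:R.
transitivity (\sum_(l < r + m) ((l == i :> nat)%:R * f l -
                                (l == i.+1 :> nat)%:R * f l)).
  apply: eq_bigr => l _; rewrite mxE entry mxE mulrACA mulVf // mul1r.
  by rewrite mulrBl.
have i1 : (i.+1 < r + m)%N.
  by move: (nat_of_ord i) iw => q; rewrite snake_sizeE !ltnS.
rewrite sumrB (pick i) ?(ltnW i1) // (pick i.+1) // /f.
by rewrite -(inj_eq val_inj) /=; case: ltngtP => _; rewrite ?subrr ?subr0.
Qed.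

End Snake.

(** * The h*-vectors of the two families *)

Lemma snake_hstar (R : realType) (a : seq nat) (h : seq int) (w := snake_moves
  false a) :
  size h = (size w).+2 ->
  (forall t, #|monotone_maps (fence w) t|%:Z =
     \sum_(j < (size w).+2) h`_j * ('C(t + (size w).+1 - j, (size w).+1))%:Z) ->
  is_hstar_vector (snake_polytope R a) h.
Proof.
by move=> sh hE; rewrite /is_hstar_vector snake_dim; split=> // t;
  rewrite snake_ehrhart.
Qed.

Lemma size_snake_moves_nseq (d : bool) (s c : nat) :
  size (snake_moves d (nseq s c.+1)) = (s * c)%N.
Proof.
elim: s d => // s IH d.
by rewrite /= size_cat size_nseq IH mulSn.
Qed.

Lemma nth_snake_moves_nseq (d : bool) (s c k : nat) : (k < s * c)%N ->
  nth false (snake_moves d (nseq s c.+1)) k = d (+) odd (k %/ c).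
Proof.
elim: s d k => // s IH d k; rewrite mulSn => ks.
have c0 : (0 < c)%N by case: c {IH} ks => //; rewrite muln0.
rewrite /= nth_cat size_nseq nth_nseq; case: ltnP => kc.
  by rewrite divn_small // addbF.
rewrite IH; last by lia.
have {2}-> : k = (k - c + c)%N by rewrite subnK.
by rewrite divnDr // divnn c0 addn1 /= addbN addNb.
Qed.

(* The rank function of the fence whose maximal chains have [c.+1] elements:
   a triangular wave of period [2 * c]. *)
Definition wave (c k : nat) : nat :=
  if odd (k %/ c) then (c - k %% c)%N else (k %% c)%N.

Lemma wave_le (c k : nat) : (0 < c)%N -> (wave c k <= c)%N.
Proof.
by move=> c0; rewrite /wave; case: ifP => _;
  rewrite ?leq_subr // ltnW ?ltn_pmod.
Qed.

Lemma divmodS (c k : nat) : (0 < c)%N ->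
  (k.+1 %/ c = k %/ c /\ k.+1 %% c = (k %% c).+1 /\ (k %% c).+1 < c \/
   k.+1 %/ c = (k %/ c).+1 /\ k.+1 %% c = 0 /\ (k %% c).+1 = c)%N.
Proof.
move=> c0; have := ltn_pmod k c0; rewrite leq_eqVlt => /orP[/eqP e|lt_c].
  right; have -> : k.+1 = ((k %/ c).+1 * c)%N.
    by rewrite {1}(divn_eq k c) -addnS e mulSn addnC.
  by rewrite mulnK // modnMl.
have kE : k.+1 = (k %/ c * c + (k %% c).+1)%N by rewrite addnS -divn_eq.
by left; rewrite kE divnMDl // modnMDl (divn_small lt_c) (modn_small lt_c)
  addn0.
Qed.

Lemma waveS (c k : nat) : (0 < c)%N ->
  if odd (k %/ c) then wave c k = (wave c k.+1).+1
  else wave c k.+1 = (wave c k).+1.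
Proof.
move=> c0; have kc := ltn_pmod k c0; rewrite /wave.
case: (divmodS k c0) => [[-> [-> lt_c]]|[-> [-> e]]].
  by case: (odd _) => //; rewrite -subSn.
by rewrite /=; case: (odd _) => /=; lia.
Qed.

Section EqualRuns.
Variables (c s : nat).
Hypotheses (c0 : (0 < c)%N) (s0 : (0 < s)%N).
Let w := snake_moves false (nseq s c.+1).
Let rho (x : 'I_(size w).+1) := wave c x.

Let size_w : size w = (s * c)%N. Proof. exact: size_snake_moves_nseq. Qed.

Let ord_le (x : 'I_(size w).+1) : (x <= s * c)%N.
Proof. by rewrite -size_w -ltnS. Qed.

Let fenceS (x y : 'I_(size w).+1) : y = x.+1 :> nat ->
  if odd (x %/ c) then fence w y x else fence w x y.
Proof.
move=> e; have xs : (x < s * c)%N by rewrite -e.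
case: ifP => odd_x; apply/orP; [right|left].
all: by rewrite e eqxx nth_snake_moves_nseq // odd_x.
Qed.

Let fence_rho x y : fence w x y -> rho y = (rho x).+1.
Proof.
case/orP=> /andP[/eqP e].
  have xs : (x < s * c)%N by rewrite -e.
  rewrite nth_snake_moves_nseq //= => /negbTE od.
  by have := waveS x c0; rewrite od -e.
have ys : (y < s * c)%N by rewrite -e.
rewrite nth_snake_moves_nseq //= => od.
by have := waveS y c0; rewrite od -e.
Qed.

Let neighbour (x : 'I_(size w).+1) (k : nat) : (k <= s * c)%N ->
  exists y : 'I_(size w).+1, y = k :> nat.
Proof. by rewrite -size_w -ltnS => ks; exists (Ordinal ks). Qed.

Let fence_down x : (0 < rho x)%N -> exists y, fence w y x.
Proof.
rewrite /rho /wave => rx.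
have xs := ord_le x.
(* At a multiple of c, positive rank means a peak, with x - 1 below it; inside a run the lower
   neighbor is x + 1 on a descent and x - 1 on an ascent. *)
have [x0|xpos] := posnP (x %% c).
  have {}rx : odd (x %/ c) by move: rx; rewrite x0; case: odd.
  case: (posnP x) => [x00|x1]; first by rewrite x00 div0n in rx.
  have [y ey] := neighbour x (leq_trans (leq_pred x) xs).
  exists y; have e : x = y.+1 :> nat by rewrite ey prednK.
  have := fenceS e; case: (divmodS y c0); rewrite -e x0; first by case=> _ [].
  by case=> xy _; move: rx; rewrite xy /= => /negbTE ->.
case odd_x: (odd (x %/ c)).
  have xs' : (x < s * c)%N.
    by rewrite ltn_neqAle xs andbT; apply: contraTneq xpos => ->;
      rewrite modnMl.
  have [y ey] := neighbour x xs'.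
  by exists y; have := fenceS ey; rewrite odd_x.
have x1 : (0 < x)%N by case: (posnP x) xpos => // ->; rewrite mod0n.
have [y ey] := neighbour x (leq_trans (leq_pred x) xs).
exists y; have e : x = y.+1 :> nat by rewrite ey prednK.
have := fenceS e; case: (divmodS y c0); rewrite -e; last first.
  by case=> _ [x0]; rewrite x0 in xpos.
by case=> xy _; rewrite -xy odd_x.
Qed.

Let fence_up x : (rho x < c)%N -> exists y, fence w x y.
Proof.
rewrite /rho /wave => rx.
have xs := ord_le x.
have up : ~~ odd (x %/ c) -> (x < s * c)%N -> exists y, fence w x y.
  move=> odd_x xs'; have [y ey] := neighbour x xs'.
  by exists y; have := fenceS ey; rewrite (negbTE odd_x).
have down y : x = y.+1 :> nat -> odd (y %/ c) -> exists y, fence w x y.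
  move=> e odd_y; have ys : (y <= s * c)%N by rewrite ltnW // -e.
  have [y' ey'] := neighbour x ys; exists y'.
  by have := @fenceS y' x; rewrite ey' odd_y; apply.
have x1 : odd (x %/ c) || (x == s * c :> nat)%N -> (0 < x)%N.
  case/orP; first by case: (posnP x) => // ->; rewrite div0n.
  by move/eqP->; rewrite muln_gt0 s0.
have [odd_x|even_x] := boolP (odd (x %/ c)).
  have e : x = x.-1.+1 :> nat by rewrite prednK // x1 // odd_x.
  apply: (down _ e); case: (divmodS x.-1 c0); rewrite -e.
    by case=> <-.
  by case=> _ [x0]; move: rx; rewrite odd_x x0 subn0 ltnn.
(* The remaining case is a fence ending in a valley, whose only neighbor is x - 1. *)
have [xs'|xs'] := ltnP x (s * c); first exact: up.
have xE : x = (s * c)%N :> nat by apply/eqP; rewrite eqn_leq xs.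
have e : x = x.-1.+1 :> nat by rewrite prednK // x1 // xE eqxx orbT.
apply: (down _ e); case: (divmodS x.-1 c0); rewrite -e.
  by case=> _ []; rewrite xE modnMl.
by case=> xx _; move: even_x; rewrite xx /= negbK.
Qed.

Lemma equal_runs_ser : exists p : {poly int},
  [/\ ((odd c).+1 <= (size w).+1)%N, gamma_pos (size w).+1 (odd c).+1 p,
      forall t : nat, #|monotone_maps (fence w) t|%:Z =
                      ser (size w).+2 p (t + c./2)
    & forall t : nat, (t < c./2)%N -> ser (size w).+2 p t = 0].
Proof.
have cw : (c < (size w).+1)%N by rewrite size_w ltnS leq_pmull.
have rho_c : rho (Ordinal cw) = c by rewrite /rho /wave /= divnn c0 modnn subn0.
have := graded_poset_ser fence_rho (fun x => wave_le x c0) fence_down fence_up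
  rho_c.
by rewrite card_ord.
Qed.

End EqualRuns.

Lemma equal_runs_unimodal (R : realType) (c s : nat) : (0 < c)%N -> (0 < s)%N ->
  exists2 h, is_hstar_vector (snake_polytope R (nseq s c.+1)) h & unimodal h.
Proof.
move=> c0 s0; have [p [lw pP pE p0]] := equal_runs_ser c0 s0.
have [h [sh uh hE]] := gamma_pos_hstar lw pP p0.
by exists h => //; apply: snake_hstar => // t; rewrite pE hE.
Qed.

Lemma two_runs_unimodal (R : realType) (p q : nat) :
  exists2 h, is_hstar_vector (snake_polytope R [:: p.+1; q.+1]) h & unimodal h.
Proof.
have wE : snake_moves false [:: p.+1; q.+1] = nseq p false ++ nseq q true.
  by rewrite /= cats0.
have size_w : size (snake_moves false [:: p.+1; q.+1]) = (p + q)%N.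
  by rewrite wE size_cat !size_nseq.
exists (mkseq (fun i => ('C(p, i) * 'C(q, i))%:Z) (p + q).+2).
  apply: snake_hstar; first by rewrite size_mkseq size_w.
  move=> t; rewrite wE card_monotone_two_runs -wE size_w.
  under eq_bigr => v _ do rewrite bin_mul_expand.
  (* Summing over the value v of the maximum raises p + q to p + q + 1 in the binomials; the entries
     beyond p vanish. *)
  rewrite exchange_big /= -natz natr_sum.
  rewrite (big_ord_widen (p + q).+2 (fun i => (\sum_(v < t.+1)
    'C(p, i) * 'C(q, i) * 'C(v + (p + q) - i, p + q))%N%:R : int)); last by lia.
  rewrite [RHS](bigID (fun i : 'I_(p + q).+2 => (i < p.+1)%N)) /=.
  rewrite [X in _ = _ + X]big1 ?addr0; last first.
    move=> i; rewrite -leqNgt => pi; rewrite nth_mkseq //.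
    by rewrite bin_small // mul0n mul0r.
  apply: eq_bigr => i; rewrite ltnS => ip.
  rewrite -big_distrr /= sum_bin_sub ?(leq_trans ip (leq_addr _ _)) //.
  by rewrite nth_mkseq // natz PoszM.
exact: binM_unimodal (leqnSn _).
Qed.

Theorem theorem4p9 (R : realType) (a b s : nat) :
  (2 <= a)%N -> (2 <= b)%N -> (1 <= s)%N ->
  (exists2 h : seq int,
     is_hstar_vector (snake_polytope R (nseq s a)) h & unimodal h) /\
  (exists2 h : seq int,
     is_hstar_vector (snake_polytope R [:: a; b]) h & unimodal h).
Proof.
case: a b => [|a] [|b] // a2 _ s1; split; last exact: two_runs_unimodal.
exact: equal_runs_unimodal.
Qed.
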